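(* If the left-Garside category $\mathcal{LD}^+$ (with left-Garside map $\Delta(t)=(t,\Delta_t,\phi(t))$) is regular, then the Embedding Conjecture is true, i.e. each of the following (equivalent) properties holds: (i) the monoid $\mathrm{LD}^+$ embeds in a group; (ii) the monoid $\mathrm{LD}^+$ admits right-cancellation; (iii) the categories $\mathcal{LD}^+_0$ and $\mathcal{LD}^+$ are isomorphic; (iv) the functor $\phi$ associated with the category $\mathcal{LD}^+$ is injective; (v) for each term $t$, the LD-expansions of $t$ make an upper-semilattice (any two LD-expansions of $t$ admit a least upper bound with respect to the ordering $\to_{\mathrm{LD}}$); (vi) the defining relations of $\mathrm{LD}^+$ generate all relations that connect the action of the $D_\alpha$'s on terms: any two finite sequences $w,w'$ of letters $D_\alpha$ satisfying $t\bullet w=t\bullet w'$ for every term $t$ such that both are defined represent the same element of $\mathrm{LD}^+$.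
   Context: **Left-Garside categories.** Composition is written left to right: $fg$ means ''$f$ then $g$''; $\partial_0 f$ and $\partial_1 f$ are the source and target of $f$; $1_x$ is the identity at $x$; a morphism is nontrivial if it is not an identity. Write $f\preccurlyeq g$ if $fh=g$ for some $h$, and $f\prec g$ if moreover $h$ can be chosen nontrivial; $\mathrm{Div}(f)$ is the collection of left-divisors of $f$. A right-lcm of $f,g$ is a $\preccurlyeq$-least common right-multiple. A category is left-preGarside if: (LG0) for each morphism $f$, every $\prec$-increasing sequence in $\mathrm{Div}(f)$ is finite; (LG1) $fg=fg'$ implies $g=g'$; (LG2) any two morphisms that admit a common right-multiple admit a right-lcm. A left-Garside map is a map $\Delta$ from objects to morphisms such that, for each object $x$, $\partial_0\Delta(x)=x$ and (LG3) every nontrivial morphism with source $x$ has a nontrivial left-divisor lying in $\mathrm{Div}(\Delta(x))$, and $f\preccurlyeq\Delta(x)$ implies $\Delta(x)\preccurlyeq f\,\Delta(\partial_1 f)$. A left-Garside category is a left-preGarside category possessing a left-Garside map. In it, a morphism $f$ is simple if $f\preccurlyeq\Delta(\partial_0 f)$; then $f^*$ is the unique (simple) morphism with $ff^*=\Delta(\partial_0 f)$. The functor $\phi$ associated with the category is the unique functor with $\phi(x)=\partial_1\Delta(x)$ on objects and $\phi(f)=f^{**}$ on simple morphisms; it satisfies $f\,\Delta(\partial_1 f)=\Delta(\partial_0 f)\,\phi(f)$ for every morphism $f$. The head $H(f)$ is the unique maximal simple left-divisor of $f$. A pair $(f_1,f_2)$ of simple morphisms with $\partial_1 f_1=\partial_0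 f_2$ is normal if $f_1=H(f_1f_2)$. The category is regular if, for all simple $f_1,f_2$ with $\partial_1f_1=\partial_0f_2$, $(f_1,f_2)$ normal implies $(\phi(f_1),\phi(f_2))$ normal. **Terms and self-distributivity.** $T$ is the set of terms, i.e. of all bracketed expressions built from variables $x_1,x_2,\dots$ with a binary operation $\star$, viewed as rooted binary trees. $\mathbb{A}$ is the set of addresses (finite sequences of $0$'s and $1$'s), $\epsilon$ the empty address; $t_{/\alpha}$ is the subterm of $t$ at address $\alpha$, if it exists ($0$ = left, $1$ = right). For $\alpha\in\mathbb{A}$, $t\bullet D_\alpha$ is defined iff $t_{/\alpha}$ exists and has the form $t_1\star(t_2\star t_3)$, and then it is the term obtained from $t$ by replacing this subterm by $(t_1\star t_2)\star(t_1\star t_3)$. For a finite sequence $w$ of letters $D_\alpha$, $t\bullet w$ is obtained by successive application from left to right, when defined. A term $t'$ is an LD-expansion of $t$, written $t\to_{\mathrm{LD}}t'$, if $t'=t\bullet w$ for some finite (possibly empty) sequence $w$. $\mathcal{LD}^+_0$ is the category whose objects are terms and whose morphisms are the pairs $(t,t')$ with $t\to_{\mathrm{LD}}t'$. $\mathrm{LD}^+$ is the monoid generated by $\{D_\alpha\mid\alpha\in\mathbb{A}\}$ subject to the following relations, for all $\alpha,\beta,\gamma\in\mathbb{A}$: $D_{\alpha0\beta}D_{\alpha1\gamma}=D_{\alpha1\gamma}D_{\alpha0\beta}$; $D_{\alpha0\beta}D_\alpha=D_\alpha D_{\alpha00\beta}D_{\alpha10\beta}$; $D_{\alpha10\beta}D_\alpha=D_\alpha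 D_{\alpha01\beta}$; $D_{\alpha11\beta}D_\alpha=D_\alpha D_{\alpha11\beta}$; $D_\alpha D_{\alpha1}D_\alpha=D_{\alpha1}D_\alpha D_{\alpha1}D_{\alpha0}$. The action of sequences induces a well-defined partial right action $t\bullet a$ of $\mathrm{LD}^+$ on $T$. $\mathcal{LD}^+$ is the category whose objects are terms and whose morphisms are triples $(t,a,t')$ with $a\in\mathrm{LD}^+$, $t\bullet a$ defined and $t\bullet a=t'$ (source $t$, target $t'$; $(t,a,t')(t',b,t'')=(t,ab,t'')$). **The map $\Delta$.** Operations on terms: $t\circledast x_i=t\star x_i$, $t\circledast(t_1\star t_2)=(t\circledast t_1)\star(t\circledast t_2)$; $\phi(x_i)=x_i$, $\phi(t_1\star t_2)=\phi(t_1)\circledast\phi(t_2)$. $\mathrm{sh}_\gamma$ is the endomorphism of $\mathrm{LD}^+$ mapping $D_\alpha$ to $D_{\gamma\alpha}$. Define $\delta_t=\Delta_t=1$ for $t$ a variable, and, for $t=t_0\star t_1$, $\delta_t=D_\epsilon\cdot\mathrm{sh}_0(\delta_{t_0})\cdot\mathrm{sh}_1(\delta_{t_1})$ and $\Delta_t=\mathrm{sh}_0(\Delta_{t_0})\cdot\mathrm{sh}_1(\Delta_{t_1})\cdot\delta_{\phi(t_1)}$. One has $t\bullet\Delta_t=\phi(t)$, and $\mathcal{LD}^+$ is a left-Garside category with left-Garside map $\Delta(t)=(t,\Delta_t,\phi(t))$; the associated functor $\phi$ acts on objects as the map $\phi$ on terms. *)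

(* Defs.v *)
From HB Require Import structures.
From mathcomp Require Import all_boot.
From mathcomp Require Import boolp.

Set Implicit Arguments.
Unset Strict Implicit.
Unset Printing Implicit Defensive.

Local Open Scope group_scope.
Local Open Scope quotient_scope.

(* Composition is written in diagram order: [mcomp f g] is "f then g". *)
Record category := Category {
  obj : Type;
  hom : obj -> obj -> Type;
  idm : forall x, hom x x;
  mcomp : forall x y z, hom x y -> hom y z -> hom x z;
  mcomp1l : forall x y (f : hom x y), mcomp (idm x) f = f;
  mcomp1r : forall x y (f : hom x y), mcomp f (idm y) = f;
  mcompA : forall x y z t (f : hom x y) (g : hom y z) (h : hom z t),
    mcomp f (mcomp g h) = mcomp (mcomp f g) h }.

Arguments mcomp {c x y z} f g.
Arguments idm {c} x.

(* Morphisms with their source and target packed, so that morphisms with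
   different endpoints can be compared. *)
Record arrow (C : category) :=
  Arrow { src : obj C; tgt : obj C; mor : hom src tgt }.
Arguments Arrow {C src tgt} mor.

Record is_functor (C D : category) (F0 : obj C -> obj D)
    (F1 : forall x y, hom x y -> hom (F0 x) (F0 y)) : Prop := {
  functor1 : forall x, F1 x x (idm x) = idm (F0 x);
  functorM : forall x y z (f : hom x y) (g : hom y z),
    F1 x z (mcomp f g) = mcomp (F1 x y f) (F1 y z g) }.

Definition on_arrows (C D : category) (F0 : obj C -> obj D)
    (F1 : forall x y, hom x y -> hom (F0 x) (F0 y)) (f : arrow C) : arrow D :=
  Arrow (F1 _ _ (mor f)).

Definition isomorphic (C D : category) : Prop :=
  exists (F0 : obj C -> obj D) (F1 : forall x y, hom x y -> hom (F0 x) (F0 y)),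
    [/\ is_functor F1, bijective F0 & bijective (on_arrows F1)].

Section Garside.

(* The map x |-> Delta x comes with the target function dt of Delta; dt is also
   the action on objects of the associated functor.  Everything here is
   relational, hence meaningful whether or not Delta is a left-Garside map. *)
Variables (C : category) (dt : obj C -> obj C).
Variable Delta : forall x : obj C, hom x (dt x).

Definition nontrivial (x y : obj C) (f : hom x y) : Prop :=
  forall z : obj C, Arrow f <> Arrow (idm z).

Definition ldiv (x y z : obj C) (f : hom x y) (g : hom x z) : Prop :=
  exists h : hom y z, mcomp f h = g.

Definition sdiv (x y z : obj C) (f : hom x y) (g : hom x z) : Prop :=
  exists2 h : hom y z, nontrivial h & mcomp f h = g.

Definition simple (x y : obj C) (f : hom x y) : Prop := ldiv f (Delta x).

Definition maximal_simple_ldiv (x y z : obj C) (h : hom x y) (f : hom x z) :=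
  [/\ simple h, ldiv h f &
      forall (y' : obj C) (g : hom x y'), simple g -> ldiv g f -> ~ sdiv h g].

Definition is_head (x y z : obj C) (h : hom x y) (f : hom x z) : Prop :=
  maximal_simple_ldiv h f /\
  forall (y' : obj C) (g : hom x y'),
    maximal_simple_ldiv g f -> Arrow g = Arrow h.

Definition normal (x y z : obj C) (f1 : hom x y) (f2 : hom y z) : Prop :=
  [/\ simple f1, simple f2 & is_head f1 (mcomp f1 f2)].

(* [is_star f g] is g = f^*, and [is_star2 f g] is g = f^**. *)
Definition is_star (x y : obj C) (f : hom x y) (g : hom y (dt x)) : Prop :=
  mcomp f g = Delta x.

Definition is_star2 (x y : obj C) (f : hom x y) (g : hom (dt x) (dt y)) :=
  exists2 f' : hom y (dt x), is_star f f' & is_star f' g.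

Record associated_functor (F : forall x y, hom x y -> hom (dt x) (dt y)) :
    Prop := {
  assoc_is_functor : is_functor F;
  assoc_simple : forall x y (f : hom x y), simple f -> is_star2 f (F x y f) }.

(* On simple morphisms the associated functor is f |-> f^**. *)
Definition regular : Prop :=
  forall (x y z : obj C) (f1 : hom x y) (f2 : hom y z)
         (g1 : hom (dt x) (dt y)) (g2 : hom (dt y) (dt z)),
    simple f1 -> simple f2 -> is_star2 f1 g1 -> is_star2 f2 g2 ->
    normal f1 f2 -> normal g1 g2.

Definition associated_functor_injective : Prop :=
  exists F : forall x y, hom x y -> hom (dt x) (dt y),
    [/\ associated_functor F,
        forall F', associated_functor F' -> forall x y f, F' x y f = F x y f &
        injective (on_arrows F)].

End Garside.

(* [Var i] stands for the variable x_(i+1). *)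
Inductive term := Var of nat | Op of term & term.
Local Notation "s ⋆ t" := (Op s t) (at level 40, left associativity).

Fixpoint tree_of_term (t : term) : GenTree.tree nat :=
  match t with
  | Var i => GenTree.Leaf i
  | s ⋆ t => GenTree.Node 0 [:: tree_of_term s; tree_of_term t]
  end.

Fixpoint term_of_tree (t : GenTree.tree nat) : option term :=
  match t with
  | GenTree.Leaf i => Some (Var i)
  | GenTree.Node _ [:: s; t] =>
      if (term_of_tree s, term_of_tree t) is (Some s', Some t')
      then Some (s' ⋆ t') else None
  | _ => None
  end.

Lemma tree_of_termK : pcancel tree_of_term term_of_tree.
Proof. by elim=> //= s -> t ->. Qed.

HB.instance Definition _ := Countable.copy term (pcan_type tree_of_termK).

(* Addresses: [false] is 0 (left) and [true] is 1 (right). *)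
Definition addr := seq bool.

(* The word w = D_(a1) ... D_(an) is represented by [:: a1; ...; an]. *)
Definition word := seq addr.

Fixpoint actD (t : term) (a : addr) : option term :=
  match a, t with
  | [::], t1 ⋆ (t2 ⋆ t3) => Some ((t1 ⋆ t2) ⋆ (t1 ⋆ t3))
  | false :: a', t1 ⋆ t2 => omap (fun s => s ⋆ t2) (actD t1 a')
  | true :: a', t1 ⋆ t2 => omap (fun s => t1 ⋆ s) (actD t2 a')
  | _, _ => None
  end.

Fixpoint actw (t : term) (w : word) : option term :=
  if w is a :: w' then obind (fun s => actw s w') (actD t a) else Some t.

Definition LDexp (t t' : term) : Prop := exists w : word, actw t w = Some t'.

Inductive LDrel : word -> word -> Prop :=
| LDrel_perp a b c :
    LDrel [:: a ++ false :: b; a ++ true :: c]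
          [:: a ++ true :: c; a ++ false :: b]
| LDrel_0 a b :
    LDrel [:: a ++ false :: b; a]
          [:: a; a ++ [:: false, false & b]; a ++ [:: true, false & b]]
| LDrel_10 a b :
    LDrel [:: a ++ [:: true, false & b]; a]
          [:: a; a ++ [:: false, true & b]]
| LDrel_11 a b :
    LDrel [:: a ++ [:: true, true & b]; a]
          [:: a; a ++ [:: true, true & b]]
| LDrel_LD a :
    LDrel [:: a; a ++ [:: true]; a]
          [:: a ++ [:: true]; a; a ++ [:: true]; a ++ [:: false]].

Inductive LDcong : word -> word -> Prop :=
| LDcong_rel u v w w' : LDrel w w' -> LDcong (u ++ w ++ v) (u ++ w' ++ v)
| LDcong_refl w : LDcong w w
| LDcong_sym w w' : LDcong w w' -> LDcong w' w
| LDcong_trans w w' w'' : LDcong w w' -> LDcong w' w'' -> LDcong w w''.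

Definition LDeq : rel word := fun w w' => `[< LDcong w w' >].

Lemma LDeqP w w' : reflect (LDcong w w') (LDeq w w').
Proof. exact: asboolP. Qed.

Lemma LDeq_equiv : equiv_class_of LDeq.
Proof.
split.
- by move=> w; apply/LDeqP; exact: LDcong_refl.
- by move=> w w'; apply/LDeqP/LDeqP; exact: LDcong_sym.
- move=> w w' w'' /LDeqP ww' /LDeqP w'w''; apply/LDeqP.
  exact: LDcong_trans ww' w'w''.
Qed.

Canonical LDeq_equivRel := EquivRelPack LDeq_equiv.

Definition LDplus := {eq_quot LDeq}.
HB.instance Definition _ := Choice.on LDplus.
HB.instance Definition _ := EqQuotient.on LDplus.

Lemma LDpi_eq w w' : \pi_LDplus w = \pi_LDplus w' <-> LDcong w w'.
Proof.
split; first by move/eqP; rewrite eqmodE => /LDeqP.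
by move=> h; apply/eqP; rewrite eqmodE; apply/LDeqP.
Qed.

Lemma LDrel_shift c w w' : LDrel w w' -> LDrel (map (cat c) w) (map (cat c) w').
Proof.
by case=> [a b d|a b|a b|a b|a]; rewrite /= !(catA c); constructor.
Qed.

Lemma LDcong_shift c w w' :
  LDcong w w' -> LDcong (map (cat c) w) (map (cat c) w').
Proof.
elim=> {w w'} [u v w w' ww'|w|w w' _|w w' w'' _ + _].
- by rewrite !map_cat; apply/LDcong_rel/LDrel_shift.
- exact: LDcong_refl.
- exact: LDcong_sym.
- exact: LDcong_trans.
Qed.

Lemma LDplusW (P : LDplus -> Prop) :
  (forall w, P (\pi_LDplus w)) -> forall a, P a.
Proof. by move=> Pw a; rewrite -(reprK a). Qed.

Lemma LDcong_cat u u' v v' :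
  LDcong u u' -> LDcong v v' -> LDcong (u ++ v) (u' ++ v').
Proof.
move=> uu' vv'; apply: (@LDcong_trans _ (u' ++ v)).
- elim: uu' => {u u'} [x y w w' ww'|w|w w' _|w w' w'' _ + _].
  + by rewrite -!catA; exact: LDcong_rel.
  + exact: LDcong_refl.
  + exact: LDcong_sym.
  + exact: LDcong_trans.
- elim: vv' => {v v'} [x y w w' ww'|w|w w' _|w w' w'' _ + _].
  + by rewrite !(catA u'); exact: LDcong_rel.
  + exact: LDcong_refl.
  + exact: LDcong_sym.
  + exact: LDcong_trans.
Qed.

Definition LDone : LDplus := \pi_LDplus [::].
Definition LDmul (a b : LDplus) : LDplus := \pi_LDplus (repr a ++ repr b).

Lemma LDmul_pi u v : LDmul (\pi_LDplus u) (\pi_LDplus v) = \pi_LDplus (u ++ v).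
Proof. by apply/LDpi_eq/LDcong_cat; apply/LDpi_eq; rewrite reprK. Qed.

Lemma LDmulA : associative LDmul.
Proof.
elim/LDplusW=> u; elim/LDplusW=> v; elim/LDplusW=> w.
by rewrite !LDmul_pi catA.
Qed.

Lemma LDmul1 : left_id LDone LDmul.
Proof. by elim/LDplusW=> u; rewrite LDmul_pi. Qed.

Lemma LDmulr1 : right_id LDone LDmul.
Proof. by elim/LDplusW=> u; rewrite LDmul_pi cats0. Qed.

HB.instance Definition _ := isMonoid.Build LDplus LDmulA LDmul1 LDmulr1.

Definition D (a : addr) : LDplus := \pi_LDplus [:: a].

Definition sh (c : addr) (a : LDplus) : LDplus :=
  \pi_LDplus (map (cat c) (repr a)).

Lemma sh_pi c w : sh c (\pi_LDplus w) = \pi_LDplus (map (cat c) w).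
Proof.
apply/LDpi_eq.
have : LDcong (repr (\pi_LDplus w)) w by apply/LDpi_eq; rewrite reprK.
exact: LDcong_shift.
Qed.

Lemma sh_morph c : monoid_morphism (sh c).
Proof.
split; first by rewrite sh_pi.
elim/LDplusW=> u; elim/LDplusW=> v.
by rewrite [_ * _]LDmul_pi !sh_pi map_cat -LDmul_pi.
Qed.

HB.instance Definition _ c :=
  isUMagmaMorphism.Build LDplus LDplus (sh c) (sh_morph c).

Lemma actw_cat t u v : actw t (u ++ v) = obind (fun s => actw s v) (actw t u).
Proof. by elim: u t => //= a u IH t; case: (actD t a). Qed.

Lemma actw_sh0 t1 t2 w :
  actw (t1 ⋆ t2) (map (cat [:: false]) w) = omap (fun s => s ⋆ t2) (actw t1 w).
Proof. by elim: w t1 => //= a w IH t1; case: (actD t1 a) => //=. Qed.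

Lemma actw_sh1 t1 t2 w :
  actw (t1 ⋆ t2) (map (cat [:: true]) w) = omap (fun s => t1 ⋆ s) (actw t2 w).
Proof. by elim: w t2 => //= a w IH t2; case: (actD t2 a) => //=. Qed.

Lemma actw_Var i w : actw (Var i) w = if w is [::] then Some (Var i) else None.
Proof. by case: w => // -[|[] a] w. Qed.

Lemma actw_LDrel t w w' : LDrel w w' -> actw t w = actw t w'.
Proof.
have shift a u v : (forall s, actw s u = actw s v) ->
    forall s, actw s (map (cat a) u) = actw s (map (cat a) v).
  move=> uv; elim: a => [|b a IH] s.
    by rewrite !(eq_map (g := id)) ?map_id.
  have E x : map (cat (b :: a)) x = map (cat [:: b]) (map (cat a) x).
    by rewrite -map_comp.
  rewrite !E; case: s => [i|s1 s2]; last first.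
    by case: b {E}; rewrite ?actw_sh0 ?actw_sh1 IH.
  by have := uv (Var i); rewrite !actw_Var; case: (u) (v) => [|? ?] [|? ?].
have root a u v u' v' : u' = map (cat a) u -> v' = map (cat a) v ->
    (forall s, actw s u = actw s v) -> actw t u' = actw t v'.
  by move=> -> -> /(shift a); apply.
case=> [a b c|a b|a b|a b|a].
- apply: (root a [:: false :: b; true :: c] [:: true :: c; false :: b]) => //.
  by case=> [i|s1 s2] //=; case Eb: (actD s1 b); case Ec: (actD s2 c) => /=;
     rewrite ?Eb ?Ec.
- apply: (root a [:: false :: b; [::]]
    [:: [::]; [:: false, false & b]; [:: true, false & b]]);
    rewrite /= ?cats0 //.
  by case=> [i|s1 [i|s2 s3]] //=; case Eb: (actD s1 b) => //=; rewrite Eb.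
- apply: (root a [:: [:: true, false & b]; [::]]
    [:: [::]; [:: false, true & b]]); rewrite /= ?cats0 //.
  by case=> [i|s1 [i|s2 s3]] //=; case: (actD s2 b).
- apply: (root a [:: [:: true, true & b]; [::]]
    [:: [::]; [:: true, true & b]]); rewrite /= ?cats0 //.
  by case=> [i|s1 [i|s2 s3]] //=; case: (actD s3 b).
- apply: (root a [:: [::]; [:: true]; [::]]
    [:: [:: true]; [::]; [:: true]; [:: false]]); rewrite /= ?cats0 //.
  by case=> [i|s1 [i|s2 [i|s3 s4]]].
Qed.

Lemma actw_LDcong t w w' : LDcong w w' -> actw t w = actw t w'.
Proof.
move=> ww'; elim: ww' t => {w w'} [u v w w' ww' t|//|w w' _ IH t|].
- rewrite !actw_cat; case: (actw t u) => //= s.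
  by rewrite !actw_cat (actw_LDrel s ww').
- by rewrite IH.
- by move=> w w' w'' _ IH1 _ IH2 t; rewrite IH1 IH2.
Qed.

(* [act t a = None] when the action of a on t is undefined. *)
Definition act (t : term) (a : LDplus) : option term := actw t (repr a).

Lemma act_pi t w : act t (\pi_LDplus w) = actw t w.
Proof. by apply: actw_LDcong; apply/LDpi_eq; rewrite reprK. Qed.

Lemma act1 t : act t 1 = Some t.
Proof. by rewrite act_pi. Qed.

Lemma actM t (a b : LDplus) :
  act t (a * b) = obind (fun s => act s b) (act t a).
Proof. by rewrite act_pi actw_cat. Qed.

Lemma act_sh0 t1 t2 a :
  act (t1 ⋆ t2) (sh [:: false] a) = omap (fun s => s ⋆ t2) (act t1 a).
Proof. by rewrite act_pi actw_sh0. Qed.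

Lemma act_sh1 t1 t2 a :
  act (t1 ⋆ t2) (sh [:: true] a) = omap (fun s => t1 ⋆ s) (act t2 a).
Proof. by rewrite act_pi actw_sh1. Qed.

Lemma LDexp_refl t : LDexp t t.
Proof. by exists [::]. Qed.

Lemma LDexp_trans t t' t'' : LDexp t t' -> LDexp t' t'' -> LDexp t t''.
Proof.
by move=> [u tu] [v tv]; exists (u ++ v); rewrite actw_cat tu.
Qed.

(* The category LD+_0: there is at most one morphism from t to t', namely a
   proof of the proposition [LDexp t t']. *)
Definition LDcat0 : category.
Proof.
refine (@Category term LDexp LDexp_refl LDexp_trans _ _ _);
  by move=> *; exact: Prop_irrelevance.
Defined.

(* The category LD+: the triple (t, a, t') is the element a of [LDhom t t']. *)
Definition LDhom (t t' : term) := {a : LDplus | act t a == Some t'}.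

Lemma LDid_subproof t : act t 1 == Some t.
Proof. by rewrite act1. Qed.

Definition LDid (t : term) : LDhom t t := exist _ 1 (LDid_subproof t).

Lemma LDcomp_subproof t t' t'' (f : LDhom t t') (g : LDhom t' t'') :
  act t (val f * val g) == Some t''.
Proof. by case: f g => a /= ta [b tb] /=; rewrite actM (eqP ta). Qed.

Definition LDcomp t t' t'' (f : LDhom t t') (g : LDhom t' t'') : LDhom t t'' :=
  exist _ (val f * val g) (LDcomp_subproof f g).

Definition LDcat : category.
Proof.
refine (@Category term LDhom LDid LDcomp _ _ _).
- by move=> t t' f; apply: val_inj; rewrite /= mul1g.
- by move=> t t' f; apply: val_inj; rewrite /= mulg1.
- by move=> t1 t2 t3 t4 f g h; apply: val_inj; rewrite /= mulgA.
Defined.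

Fixpoint distr (t s : term) : term :=
  match s with
  | Var _ => t ⋆ s
  | s1 ⋆ s2 => distr t s1 ⋆ distr t s2
  end.

Fixpoint phi (t : term) : term :=
  match t with
  | Var _ => t
  | t1 ⋆ t2 => distr (phi t1) (phi t2)
  end.

Fixpoint delta (t : term) : LDplus :=
  match t with
  | Var _ => 1
  | t0 ⋆ t1 => D [::] * sh [:: false] (delta t0) * sh [:: true] (delta t1)
  end.

Fixpoint DeltaLD (t : term) : LDplus :=
  match t with
  | Var _ => 1
  | t0 ⋆ t1 =>
      sh [:: false] (DeltaLD t0) * sh [:: true] (DeltaLD t1) * delta (phi t1)
  end.

Lemma act_delta s t : act (s ⋆ t) (delta t) = Some (distr s t).
Proof.
elim: t => [i|t0 IH0 t1 IH1] /=; first by rewrite act1.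
by rewrite !actM act_pi /= act_sh0 IH0 /= act_sh1 IH1.
Qed.

Lemma act_Delta t : act t (DeltaLD t) == Some (phi t).
Proof.
apply/eqP; elim: t => [i|t0 IH0 t1 IH1] /=; first by rewrite act1.
by rewrite !actM act_sh0 IH0 /= act_sh1 IH1 /= act_delta.
Qed.

Definition LDgarside (t : obj LDcat) : hom t (phi t : obj LDcat) :=
  exist _ (DeltaLD t) (act_Delta t).

Definition embeds_in_group (M : monoidType) : Prop :=
  exists (G : groupType) (f : M -> G), monoid_morphism f /\ injective f.

Definition right_cancellative (M : monoidType) : Prop :=
  forall a b c : M, a * c = b * c -> a = b.

Definition upper_semilattice (T : Type) (P : T -> Prop) (le : T -> T -> Prop) :=
  [/\ forall x, P x -> le x x,
      forall x y, P x -> P y -> le x y -> le y x -> x = y,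
      forall x y z, P x -> P y -> P z -> le x y -> le y z -> le x z &
      forall x y, P x -> P y ->
        exists z, [/\ P z, le x z, le y z &
          forall z', P z' -> le x z' -> le y z' -> le z z']].

(* Main.v *)
(* Right reversing shows that LD+ is left cancellative with right lcms: each pair
   of letters has a unique defining relation, the cube condition holds for all
   triples of letters, and the growth of terms under the action provides
   noetherianity.  For a simple at t, relabel t with strictly increasing leaves:
   t•a then determines a, so phi is injective on simple morphisms.  Regularity
   says that phi preserves normal pairs, hence heads, so phi is injective on all
   morphisms by induction on normal forms.  Since f Delta(t') = Delta(t) phi(f),
   two elements with a common right multiplier have the same image under phi:
   this is right cancellation, and Ore's theorem embeds LD+ in a group G.  In G
   each term t has a blueprint chi(t) with chi(t•a) = chi(t) sh_0(a), so t and
   t•a determine a; the remaining properties follow from this faithfulness. *)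

Require Import Defs.
From mathcomp Require Import all_boot.
From HB Require Import structures.
From mathcomp Require Import boolp zify.

Set Implicit Arguments.
Unset Strict Implicit.
Unset Printing Implicit Defensive.

Local Open Scope group_scope.
Local Open Scope quotient_scope.
Local Notation "s ⋆ t" := (Op s t) (at level 40, left associativity).

(** * Complements of the generators *)

(** The two sides of the LD relation have lengths 3 and 4, so word length supports no induction in
    LD+; instead every element acts on some sufficiently deep term, and [tsize] along that action
    replaces length. The cube condition cannot be checked outright, because some of its cases cancel
    letters, which is what it is meant to prove; it is relativised to [good] elements and freed from
    that hypothesis by induction on right divisors. Simple elements are separated by their targets
    because, on increasing labels, rightmost variables of the target record which letters D_(1...1)
    were used. This argument fails for other elements, whose targets need not be [ordered], and
    regularity bridges the gap. Right cancellation is proved letter by letter: if D_x applies to t•a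
    then D_x divides Delta(t•a), so a D_x = b D_x gives a Delta = b Delta, hence phi(a) = phi(b).
    Faithfulness at arbitrary terms comes after the embedding in a group because the blueprint of a
    product involves an inverse. *)

Fixpoint tsize (t : term) : nat :=
  if t is t1 ⋆ t2 then (tsize t1 + tsize t2)%N else 1%N.

Lemma tsize_gt0 t : (0 < tsize t)%N.
Proof. by elim: t => //= t1 IH1 t2 _; rewrite ltn_addr. Qed.

Lemma pi_cons a w : \pi_LDplus (a :: w) = D a * \pi_LDplus w.
Proof. by rewrite [RHS]LDmul_pi. Qed.

Lemma pi_cat u v : \pi_LDplus (u ++ v) = \pi_LDplus u * \pi_LDplus v.
Proof. by rewrite [RHS]LDmul_pi. Qed.

Lemma act_D t a : act t (D a) = actD t a.
Proof. by rewrite act_pi /=; case: (actD t a). Qed.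

Lemma act_tsize_D t a t' : act t (D a) = Some t' -> (tsize t < tsize t')%N.
Proof.
rewrite act_D; elim: a t t' => [|[] a IH] [i|t1 t2] t' //=.
- case: t2 => [//|t2 t3] [<-] /=.
  by have := tsize_gt0 t1; lia.
- by case E: (actD t2 a) => [s|] //= [<-] /=; rewrite ltn_add2l (IH t2).
- by case E: (actD t1 a) => [s|] //= [<-] /=; rewrite ltn_add2r (IH t1).
Qed.

Lemma act_Some t m m' t' : act t (m * m') = Some t' ->
  exists2 t1, act t m = Some t1 & act t1 m' = Some t'.
Proof. by rewrite actM; case: (act t m) => [t1|] //= e; exists t1. Qed.

Lemma act_comp t m t1 m' : act t m = Some t1 -> act t (m * m') = act t1 m'.
Proof. by rewrite actM => ->. Qed.

Lemma LD_ind (P : LDplus -> Prop) :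
  P 1 -> (forall a m, P m -> P (D a * m)) -> forall m, P m.
Proof.
move=> P1 PD; elim/LDplusW; elim=> [//|a w IH].
by rewrite pi_cons; apply: PD.
Qed.

Lemma LD_rcons_ind (P : LDplus -> Prop) :
  P 1 -> (forall a m, P m -> P (m * D a)) -> forall m, P m.
Proof.
move=> P1 PD; elim/LDplusW; elim/last_ind=> [//|w a IH].
by rewrite -cats1 -LDmul_pi; apply: PD.
Qed.

Lemma act_tsize t m t' : act t m = Some t' -> (tsize t <= tsize t')%N.
Proof.
elim/LD_ind: m t => [|a m IH] t; first by rewrite act1 => -[->].
by move/act_Some=> [t1 /act_tsize_D/ltnW le1 /IH]; apply: leq_trans.
Qed.

Lemma LD_case m : m = 1 \/ exists a m', m = D a * m'.
Proof.
by elim/LD_ind: m => [|a m _]; [left | right; exists a, m].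
Qed.

Lemma act_same_tsize t m t' : act t m = Some t' -> tsize t' = tsize t -> m = 1.
Proof.
case: (LD_case m) => [//|[a [m' ->]] /act_Some[t1 /act_tsize_D lt1 /act_tsize]].
by move=> le1 e; rewrite e leqNgt lt1 in le1.
Qed.

Fixpoint deep n (t : term) : bool :=
  if n is n'.+1 then if t is t1 ⋆ t2 then deep n' t1 && deep n' t2 else false
  else true.

Arguments deep : simpl never.

Lemma deepS n t1 t2 : deep n.+1 (t1 ⋆ t2) = deep n t1 && deep n t2.
Proof. by []. Qed.

Lemma deepW n t : deep n.+1 t -> deep n t.
Proof.
elim: n t => [//|n IH] [//|t1 t2]; rewrite !deepS => /andP[/IH-> /IH->] //.
Qed.

(** One level of depth is given up at each letter; the initial depth is free, so this crude bound
    suffices for any finite word. *)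
Lemma deep_actD n a t : deep (n + (size a).+2) t ->
  exists2 t', actD t a = Some t' & deep (n + (size a).+1) t'.
Proof.
elim: a n t => [|b a IH] n t.
  rewrite addn2 addn1; case: t => // t1 [i|t2 t3]; first by rewrite deepS andbF.
  rewrite !deepS => /and3P[d1 d2 d3]; exists (t1 ⋆ t2 ⋆ (t1 ⋆ t3)) => //.
  rewrite deepS; case: n d1 d2 d3 => [//|n] d1 d2 d3.
  by rewrite !deepS (deepW (deepW d1)) (deepW d2) (deepW d3).
rewrite (addnS n (size (b :: a)).+1) (addnS n (size (b :: a))) [size _]/=.
case: t => // t1 t2; rewrite deepS => /andP[d1 d2].
have [s1 e1 f1] : exists2 s, actD t1 a = Some s & deep (n + (size a).+1) s.
  by apply: IH; rewrite addnS.
have [s2 e2 f2] : exists2 s, actD t2 a = Some s & deep (n + (size a).+1) s.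
  by apply: IH; rewrite addnS.
move/deepW in d1; move/deepW in d2.
by case: b; rewrite /= ?e1 ?e2 /=; eexists; try reflexivity;
  rewrite deepS ?f1 ?f2 ?d1 ?d2.
Qed.

Lemma deep_leq m n t : (m <= n)%N -> deep n t -> deep m t.
Proof.
by move/subnK <-; elim: (n - m)%N => [//|k IH]; rewrite addSn => /deepW.
Qed.

Lemma deep_actw w : exists n, forall t, deep n t -> exists t', actw t w = Some t'.
Proof.
suff [n nP] : exists n, forall k t, deep (k + n) t ->
    exists2 t', actw t w = Some t' & deep k t'.
  by exists n => t /(nP 0%N)[t' e _]; exists t'.
elim: w => [|a w [n IH]]; first by exists 0%N => k t; rewrite addn0; exists t.
exists (n + (size a).+2)%N => k t; rewrite addnA => /deep_actD[t' e1 d1] /=.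
rewrite e1 /=; apply: IH; apply: deep_leq d1; exact: leq_addr.
Qed.

Fixpoint full_term n : term :=
  if n is n'.+1 then full_term n' ⋆ full_term n' else Var 0.

Lemma deep_full n : deep n (full_term n).
Proof. by elim: n => // n IH; rewrite deepS IH. Qed.

(** A large depth alone guarantees that a word applies, so one full binary tree serves both
    elements. *)
Lemma act_common_term m1 m2 :
  exists t t1 t2, act t m1 = Some t1 /\ act t m2 = Some t2.
Proof.
elim/LDplusW: m1 => w1; elim/LDplusW: m2 => w2.
have [n1 d1] := deep_actw w1; have [n2 d2] := deep_actw w2.
exists (full_term (maxn n1 n2)).
have [|t1 e1] := d1 (full_term (maxn n1 n2)).
  by apply: deep_leq (deep_full _); apply: leq_maxl.
have [|t2 e2] := d2 (full_term (maxn n1 n2)).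
  by apply: deep_leq (deep_full _); apply: leq_maxr.
by exists t1, t2; rewrite !act_pi.
Qed.

Definition tail_of (m' m : LDplus) : Prop := exists a, m = D a * m'.

(** Let m carry t to t'. Removing the first letter replaces t by a strictly larger term and keeps
    t', so the gap between the two sizes bounds the descent. *)
Lemma tail_wf : well_founded tail_of.
Proof.
move=> m; have [t [t' [_ [e _]]]] := act_common_term m m.
have [N le_N] : exists N, (tsize t' <= N + tsize t)%N.
  by exists (tsize t'); rewrite leq_addr.
elim: N t t' m e le_N => [|N IH] t t' m e le_N; constructor=> m' [a em].
  move: e; rewrite em => /act_Some[t1 /act_tsize_D lt1 /act_tsize le1].
  by have := leq_trans lt1 (leq_trans le1 le_N); rewrite ltnn.
move: e; rewrite em => /act_Some[t1 /act_tsize_D lt1 e1].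
apply: IH e1 _; apply: leq_trans le_N _.
by rewrite addSnnS leq_add2l.
Qed.

(* The word C(a,b) with D_a C(a,b) = D_b C(b,a) prescribed by the unique
   defining relation between D_a and D_b. *)
Fixpoint compl (a b : addr) {struct a} : word :=
  match a, b with
  | [::], [::] => [::]
  | [::], false :: b' => [:: [:: false, false & b']; [:: true, false & b']]
  | [::], [:: true] => [:: [:: true]; [::]]
  | [::], [:: true, false & b'] => [:: [:: false, true & b']]
  | [::], [:: true, true & b'] => [:: [:: true, true & b']]
  | [:: true], [::] => [:: [::]; [:: true]; [:: false]]
  | _ :: _, [::] => [:: [::]]
  | false :: a', false :: b' => map (cons false) (compl a' b')
  | true :: a', true :: b' => map (cons true) (compl a' b')
  | _ :: _, _ :: _ => [:: b]
  end.

Lemma compl_cons x a b : compl (x :: a) (x :: b) = map (cons x) (compl a b).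
Proof. by case: x a => [] [|[] a]. Qed.

Lemma compl_neq x y a b : x != y -> compl (x :: a) (y :: b) = [:: y :: b].
Proof. by case: x y a => [] [] [|[] a]. Qed.

Lemma compl_id a : compl a a = [::].
Proof. by elim: a => [//|x a IH]; rewrite compl_cons IH. Qed.

Lemma compl_cat p a b : compl (p ++ a) (p ++ b) = map (cat p) (compl a b).
Proof.
elim: p => [|x p IH]; first by rewrite map_id.
by rewrite !cat_cons compl_cons IH -map_comp.
Qed.

Lemma LDrel_compl w w' : LDrel w w' ->
  exists a b, w = a :: compl a b /\ w' = b :: compl b a.
Proof.
case=> [a b c|a b|a b|a b|a].
- by exists (a ++ false :: b), (a ++ true :: c); rewrite !compl_cat !compl_neq.
- exists (a ++ false :: b), (a ++ [::]).
  by rewrite !compl_cat /= cats0.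
- exists (a ++ [:: true, false & b]), (a ++ [::]).
  by rewrite !compl_cat /= cats0.
- exists (a ++ [:: true, true & b]), (a ++ [::]).
  by rewrite !compl_cat /= cats0.
- exists (a ++ [::]), (a ++ [:: true]).
  by rewrite !compl_cat /= cats0.
Qed.

(** Products are nested to the right with a free tail [z], so that relations rewrite inside a
    product without reassociating; the prefix [p] lets one identity serve at every address. *)
Definition lact (p : addr) (w : word) (z : LDplus) : LDplus :=
  foldr (fun a z => D (p ++ a) * z) z w.

Lemma lact_cat p u v z : lact p (u ++ v) z = lact p u (lact p v z).
Proof. by rewrite /lact foldr_cat. Qed.

Lemma lact_map p q w z : lact p (map (cat q) w) z = lact (p ++ q) w z.
Proof. by elim: w => //= a w ->; rewrite catA. Qed.

Lemma lact_map1 p x w z : lact p (map (cons x) w) z = lact (rcons p x) w z.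
Proof. by rewrite -cats1 -lact_map. Qed.

Lemma lact_nil w z : lact [::] w z = \pi_LDplus w * z.
Proof.
elim: w => [|a w IH]; first by rewrite mul1g.
by rewrite pi_cons -mulgA -IH.
Qed.

Lemma LDrel_lact w w' z : LDrel w w' -> lact [::] w z = lact [::] w' z.
Proof.
move=> ww'; rewrite !lact_nil; congr (_ * z); apply/LDpi_eq.
by have := LDcong_rel [::] [::] ww'; rewrite /= !cats0.
Qed.

Section Prefix.
Variable p : addr.
Local Notation L a := (D (p ++ a)).

Lemma slide0 q b z :
  L (q ++ false :: b) * (L q * z) =
  L q * (L (q ++ [:: false, false & b]) * (L (q ++ [:: true, false & b]) * z)).
Proof. by have /LDrel_lact := LDrel_0 (p ++ q) b; rewrite -!catA; apply. Qed.

Lemma slide10 q b z :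
  L (q ++ [:: true, false & b]) * (L q * z) =
  L q * (L (q ++ [:: false, true & b]) * z).
Proof. by have /LDrel_lact := LDrel_10 (p ++ q) b; rewrite -!catA; apply. Qed.

Lemma slide11 q b z :
  L (q ++ [:: true, true & b]) * (L q * z) =
  L q * (L (q ++ [:: true, true & b]) * z).
Proof. by have /LDrel_lact := LDrel_11 (p ++ q) b; rewrite -!catA; apply. Qed.

Lemma slideLD q z :
  L q * (L (q ++ [:: true]) * (L q * z)) =
  L (q ++ [:: true]) * (L q * (L (q ++ [:: true]) * (L (q ++ [:: false]) * z))).
Proof. by have /LDrel_lact := LDrel_LD (p ++ q); rewrite -!catA; apply. Qed.

Fixpoint orth (a b : addr) : bool :=
  match a, b with
  | true :: a', true :: b' | false :: a', false :: b' => orth a' b'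
  | _ :: _, _ :: _ => true
  | _, _ => false
  end.

Lemma orth_sym a b : orth a b = orth b a.
Proof. by elim: a b => [|[] a IH] [|[] b] //=; apply: IH. Qed.

Lemma orth_compl a b : orth a b -> compl a b = [:: b].
Proof.
by elim: a b => [|[] a IH] [|[] b] // ab; rewrite ?compl_cons ?compl_neq // IH.
Qed.

Lemma orth_split a b : orth a b -> exists q x a' b',
  a = q ++ x :: a' /\ b = q ++ ~~ x :: b'.
Proof.
elim: a b => [|x a IH] [|y b] //; first by case: x.
have [<-|xy _] := eqVneq x y.
  have -> : orth (x :: a) (x :: b) = orth a b by case: x.
  by case/IH=> [q [z [a' [b' [-> ->]]]]]; exists (x :: q), z, a', b'.
by exists [::], x, a, b; case: x y xy => [] [].
Qed.

Lemma slide_orth a b z : orth a b -> L a * (L b * z) = L b * (L a * z).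
Proof.
case/orth_split=> q [x [a' [b' [-> ->]]]].
case: x; [have /LDrel_lact := LDrel_perp (p ++ q) b' a' |
          have /LDrel_lact := LDrel_perp (p ++ q) a' b'];
rewrite -!catA; move=> e; [symmetry|]; exact: e.
Qed.

Lemma lact_orth1 a w z : all (orth a) w -> L a * lact p w z = lact p w (L a * z).
Proof.
elim: w => //= b w IH /andP[ab aw].
by rewrite slide_orth // IH.
Qed.

Lemma lact_orth u v z : all (fun a => all (orth a) v) u ->
  lact p u (lact p v z) = lact p v (lact p u z).
Proof.
by elim: u => //= a u IH /andP[av uv]; rewrite IH // lact_orth1.
Qed.

End Prefix.

Lemma lact_compl p a b z :
  D (p ++ a) * lact p (compl a b) z = D (p ++ b) * lact p (compl b a) z.
Proof.
elim: a b p => [|x a IH] [|y b] p //.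
- case: y b => [[|[] b]|b] /=; last exact: (esym (slide0 p [::] b z)).
  + exact: (slideLD p [::] z).
  + exact: (esym (slide11 p [::] b z)).
  + exact: (esym (slide10 p [::] b z)).
- case: x a {IH} => [[|[] b]|b] /=; last exact: (slide0 p [::] b z).
  + exact: (esym (slideLD p [::] z)).
  + exact: (slide11 p [::] b z).
  + exact: (slide10 p [::] b z).
- have [<-|xy] := eqVneq x y.
    by rewrite !compl_cons !lact_map1 -!cat_rcons; apply: IH.
  rewrite (compl_neq _ _ xy) compl_neq 1?eq_sym //=; apply: (slide_orth p).
  by case: x y xy {IH} => [] [].
Qed.

(* That a relation D_a u = D_b v always factors through the defining relation
   between D_a and D_b is proved by induction on right divisors, so the cube
   condition may assume it for all right divisors of a given element. *)
Definition split_at (m : LDplus) : Prop := forall a b u v,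
  m = D a * u -> m = D b * v ->
  exists w, u = lact [::] (compl a b) w /\ v = lact [::] (compl b a) w.

Definition good (m : LDplus) : Prop := forall u v, m = u * v -> split_at v.

Lemma good_tl a m : good (D a * m) -> good m.
Proof. by move=> g u v e; apply: (g (D a * u)); rewrite e mulgA. Qed.

Lemma good_lact p w z : good (lact p w z) -> good z.
Proof. by elim: w => //= a w IH /good_tl. Qed.

Section Good.
Variable p : addr.
Local Notation L a := (D (p ++ a)).

Lemma good_split a b u v : good (L a * u) -> L a * u = L b * v ->
  exists w, [/\ u = lact p (compl a b) w, v = lact p (compl b a) w,
                good u & good v].
Proof.
move=> g e; have [w [eu ev]] := g 1 _ (esym (mul1g _)) _ _ _ _ erefl e.
exists w; rewrite eu ev !compl_cat !lact_map; split=> //.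
  by move/good_tl: g; rewrite eu compl_cat lact_map.
by move: g; rewrite e => /good_tl; rewrite ev compl_cat lact_map.
Qed.

Lemma cancel_good a u v : good (L a * u) -> L a * u = L a * v -> u = v.
Proof.
by move=> g e; have [w [-> ->]] := good_split g e; rewrite compl_id.
Qed.

Lemma cancel_lact w u v : good (lact p w u) -> lact p w u = lact p w v -> u = v.
Proof.
elim: w => //= a w IH g e; apply: IH; first exact: good_tl g.
exact: cancel_good g e.
Qed.

Lemma split_orth1 a w x y : all (orth a) w -> good (L a * x) ->
  L a * x = lact p w y -> exists v, x = lact p w v /\ y = L a * v.
Proof.
elim: w x y => [|b w IH] x y; first by move=> _ _ /= <-; exists x.
move=> /= /andP[ab aw] g e; have [w' [ex ey gx gy]] := good_split g e.
rewrite (orth_compl ab) /= in ex; rewrite orth_sym in ab.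
rewrite (orth_compl ab) /= in ey; rewrite ey in gy.
have [v [e1 ->]] := IH w' y aw gy (esym ey).
by exists v; rewrite ex e1.
Qed.

Lemma split_orth u w x y : all (fun a => all (orth a) w) u ->
  good (lact p u x) -> lact p u x = lact p w y ->
  exists v, x = lact p w v /\ y = lact p u v.
Proof.
elim: u x y => [|a u IH] x y; first by move=> _ _ /= ->; exists y.
move=> /= /andP[aw uw] g e; have [v [e1 ->]] := split_orth1 aw g e.
have [v' [-> ->]] := IH _ _ uw (good_tl g) e1.
by exists v'.
Qed.

(** This is what transitivity of D_a u = D_c z = D_b v requires: two factorisations that pass
    through the letter c combine into one through the relation between D_a and D_b. *)
Definition cube a b c := forall x y,
  good (lact p (compl c a) x) -> lact p (compl c a) x = lact p (compl c b) y ->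
  exists r, lact p (compl a c) x = lact p (compl a b) r /\
            lact p (compl b c) y = lact p (compl b a) r.

Lemma cube_sym a b c : cube a b c -> cube b a c.
Proof.
move=> abc x y g e; have g' : good (lact p (compl c a) y) by rewrite -e.
by have [r [? ?]] := abc y x g' (esym e); exists r.
Qed.

Lemma cube_eq12 a c : cube a a c.
Proof.
move=> x y g e; exists (lact p (compl a c) x); rewrite compl_id /=.
by rewrite (cancel_lact g e).
Qed.

Lemma cube_eq13 a b : cube a b a.
Proof. by move=> x y g; rewrite compl_id /= => ->; exists y. Qed.

Lemma cube_eq23 a b : cube a b b.
Proof. exact/cube_sym/cube_eq13. Qed.

(** The words [wb] and [wc] present the right lcm of C(a,b) and C(a,c), relative to good
    elements. *)
Definition join_compl a b c wb wc :=
  (forall z, lact p (compl a b) (lact p wb z) = lact p (compl a c) (lact p wc z))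
  /\ forall x y, good (lact p (compl a b) x) ->
     lact p (compl a b) x = lact p (compl a c) y ->
     exists z, x = lact p wb z /\ y = lact p wc z.

(* A common value of the three joins makes the cube condition symmetric under
   all permutations of the three letters. *)
Definition cubes a b c := [/\ cube a b c, cube a c b & cube b c a].

(** Each word leads from a pairwise lcm to the lcm of the three letters. Since the joins at a, b and
    c share these words, a factorisation found at one letter is transported to the other two. *)
Lemma triple a b c wab wac wbc :
  join_compl a b c wab wac -> join_compl b a c wab wbc ->
  join_compl c a b wac wbc -> cubes a b c.
Proof.
move=> [ea ja] [eb jb] [ec jc]; split=> x y g e.
- by have [z [-> ->]] := jc x y g e; exists (lact p wab z); rewrite ea eb.
- by have [z [-> ->]] := jb x y g e; exists (lact p wac z); rewrite ea ec.
- by have [z [-> ->]] := ja x y g e; exists (lact p wbc z); rewrite ec eb.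
Qed.

End Good.

(** * The cube condition *)

(* At addresses below p, the letters other than D_p and D_(p1) all slide
   through D_p, becoming words in letters strictly below p. *)
Definition light (a : addr) : bool :=
  match a with false :: _ | true :: _ :: _ => true | _ => false end.

(** What a light word becomes once D_p has been moved in front of it. *)
Definition theta (w : word) : word := flatten (map (compl [::]) w).

Section Cube.
Variable p : addr.
Local Notation L a := (D (p ++ a)).
Local Notation O := false.
Local Notation I := true.

Lemma compl_light a : light a -> compl a [::] = [:: [::]].
Proof. by case: a => [|[] [|? ?]]. Qed.

Lemma light_orth a b : light b -> orth a b -> all light (compl a b).
Proof. by move=> lb /orth_compl -> /=; rewrite lb. Qed.

Lemma light_map q w : light q -> all light (map (cat q) w).
Proof. by case: q => [|[] [|x q]] // _; rewrite all_map; apply/allP. Qed.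

Variant light_spec : addr -> Prop :=
| LightO a : light_spec (O :: a)
| LightIO a : light_spec [:: I, O & a]
| LightII a : light_spec [:: I, I & a].

Lemma lightP a : light a -> light_spec a.
Proof. by case: a => [|[] [|[] a]] // _; constructor. Qed.

Lemma light_compl a b : light a -> light b -> all light (compl a b).
Proof.
move=> la lb; case/lightP: (la) (lb) => a' lb'; case/lightP: lb' lb => b' lb;
  try exact: (light_orth lb).
- by rewrite (compl_cat [:: O] a' b') light_map.
- by rewrite (compl_cat [:: I; O] a' b') light_map.
- by rewrite (compl_cat [:: I; I] a' b') light_map.
Qed.

Lemma lact_slide w z : all light w ->
  lact p w (L [::] * z) = L [::] * lact p (theta w) z.
Proof.
elim: w => //= a w IH /andP[la lw]; rewrite IH //.
have := lact_compl p a [::] (lact p (theta w) z).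
by rewrite compl_light // => -> ; rewrite /theta /= lact_cat.
Qed.

Lemma split_light w x y : all light w -> good (L [::] * x) ->
  L [::] * x = lact p w y ->
  exists v, x = lact p (theta w) v /\ y = L [::] * v.
Proof.
elim: w x y => [|a w IH] x y; first by move=> _ _ /= <-; exists x.
move=> /= /andP[la lw] g e; have [w' [ex ey gx gy]] := good_split g e.
rewrite (compl_light la) /= in ey; rewrite ey in gy.
have [v [e1 ->]] := IH w' y lw gy (esym ey).
by exists v; rewrite ex e1 /theta /= lact_cat.
Qed.

Lemma join_orth a b c : all (fun x => all (orth x) (compl a c)) (compl a b) ->
  join_compl p a b c (compl a c) (compl a b).
Proof.
move=> o; split=> [z|x y g e]; first by rewrite lact_orth.
exact: split_orth o g e.
Qed.

Lemma join_shift q a b c a' b' :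
  compl a b = [:: q ++ a'] -> compl a c = [:: q ++ b'] ->
  join_compl p a b c (map (cat q) (compl a' b')) (map (cat q) (compl b' a')).
Proof.
rewrite /join_compl => -> -> /=; split=> [z|x y g e].
  by rewrite -!compl_cat lact_compl.
by have [w [-> -> _ _]] := good_split g e; exists w; rewrite !compl_cat.
Qed.

Lemma thetaO w z : lact p (theta (map (cat [:: O]) w)) z =
  lact p (map (cat [:: O; O]) w) (lact p (map (cat [:: I; O]) w) z).
Proof.
rewrite /theta; elim: w => //= a w ->; congr (_ * _).
by rewrite lact_orth1 // all_map; apply/allP.
Qed.

Lemma thetaIO w : theta (map (cat [:: I; O]) w) = map (cat [:: O; I]) w.
Proof. by rewrite /theta; elim: w => //= a w ->. Qed.

Lemma thetaII w : theta (map (cat [:: I; I]) w) = map (cat [:: I; I]) w.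
Proof. by rewrite /theta; elim: w => //= a w ->. Qed.

Lemma theta1 a : theta [:: a] = compl [::] a.
Proof. by rewrite /theta /= cats0. Qed.

(** D_p duplicates a letter below p0 into copies below p00 and p10. The two families of copies
    commute, so the join is computed separately in each. *)
Lemma join_root_OO a b :
  join_compl p [::] (O :: a) (O :: b)
    (theta (compl (O :: a) (O :: b))) (theta (compl (O :: b) (O :: a))).
Proof.
rewrite !(compl_cat [:: O]); split=> [z|x y /= g e]; rewrite ?thetaO.
  have orthIO c w : all (orth [:: I, O & c]) (map (cat [:: O; O]) w).
    by rewrite all_map; apply/allP.
  rewrite /= !(lact_orth1 p _ (orthIO _ _)).
  have := lact_compl p [:: I, O & a] [:: I, O & b] z.
  rewrite !(compl_cat [:: I; O]) => ->.
  have := lact_compl p [:: O, O & a] [:: O, O & b].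
  by rewrite !(compl_cat [:: O; O]) => ->.
have [w [ex ey gx gy]] := good_split g e.
rewrite !(compl_cat [:: O; O] a b, compl_cat [:: O; O] b a) in ex ey.
have oOO c d : all (orth [:: I, O & c]) (map (cat [:: O; O]) d).
  by rewrite all_map; apply/allP.
have [w1 [ex1 ew]] := split_orth1 (oOO _ _) gx ex.
have [w2 [ey1 ew']] := split_orth1 (oOO _ _) gy ey.
have gw : good w by move: gx; rewrite ex => /good_lact.
rewrite ew in ew' gw; have [v [ev1 ev2 _ _]] := good_split gw ew'.
exists v; rewrite !thetaO ex1 ey1 ev1 ev2.
by rewrite !(compl_cat [:: I; O] a b, compl_cat [:: I; O] b a).
Qed.

Lemma join_root_light a b : light a -> light b ->
  join_compl p [::] a b (theta (compl a b)) (theta (compl b a)).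
Proof.
have jo c d : orth c d ->
    all (fun x => all (orth x) (compl [::] d)) (compl [::] c) ->
    join_compl p [::] c d (theta (compl c d)) (theta (compl d c)).
  move=> cd cd'; have dc := cd; rewrite orth_sym in dc.
  by rewrite !orth_compl // !theta1; apply: join_orth.
move=> la lb; case/lightP: (la) (lb) => a' lb'; case/lightP: lb' lb => b' lb;
  try exact: jo.
- exact: join_root_OO.
- rewrite !(compl_cat [:: I; O] a' b', compl_cat [:: I; O] b' a') !thetaIO.
  exact: (join_shift (q := [:: O; I])).
- rewrite !(compl_cat [:: I; I] a' b', compl_cat [:: I; I] b' a') !thetaII.
  exact: (join_shift (q := [:: I; I])).
Qed.

(** Light letters slide through D_p, so the triple lcm is the lcm of the two light letters pushed
    through D_p. *)
Lemma cubes_root_light a b : light a -> light b -> cubes p a b [::].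
Proof.
move=> la lb; have lab := light_compl la lb; have lba := light_compl lb la.
apply: (@triple p a b [::] [:: [::]] (theta (compl a b)) (theta (compl b a))).
- split=> [z|x y g e]; first by rewrite (compl_light la) lact_slide.
  rewrite (compl_light la) in e; have g' : good (L [::] * y) by rewrite -[_ * y]e.
  by have [v [-> ->]] := split_light lab g' (esym e); exists v.
- split=> [z|x y g e]; first by rewrite (compl_light lb) lact_slide.
  rewrite (compl_light lb) in e; have g' : good (L [::] * y) by rewrite -[_ * y]e.
  by have [v [-> ->]] := split_light lba g' (esym e); exists v.
- exact: join_root_light.
Qed.

(** Seen from such a [b], the letters D_p and D_(p1) are unchanged, so what has to be joined is
    their LD relation. *)
Lemma join_light_1 b : compl b [::] = [:: [::]] -> compl b [:: I] = [:: [:: I]] ->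
  join_compl p b [::] [:: I] [:: [:: I]; [::]] [:: [::]; [:: I]; [:: O]].
Proof.
rewrite /join_compl => -> ->; split=> [z|x y /= g e].
  by rewrite /= (slideLD p [::]).
by have [w [/= -> -> _ _]] := good_split g e; exists w.
Qed.

(** The lcm of D_p and D_(p1) turns t0⋆(t1⋆(t2⋆t3)) into ((t0⋆t1)⋆(t0⋆t2))⋆((t0⋆t1)⋆(t0⋆t3)). Here
    t0 ends at 000, 010, 100 and 110, whence the four letters of the first word. The next three
    lemmas follow in the same way the copies of t1 (001, 101), t2 (011) and t3 (111). *)
Lemma cubes_root_1_O b : cubes p [::] [:: I] (O :: b).
Proof.
apply: (@triple p [::] [:: I] (O :: b)
  [:: [:: O, O, O & b]; [:: I, O, O & b]; [:: O, I, O & b]; [:: I, I, O & b]]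
  [:: [:: I]; [::]] [:: [::]; [:: I]; [:: O]]); last exact: join_light_1.
- split=> [z|x y /= g e] /=.
    rewrite (slide0 p [:: I] b) (slide_orth p (a := [:: O, O & b])) //.
    by rewrite (slide11 p [::] (O :: b)) (slide10 p [::] (O :: b))
      (slide0 p [::] (O :: b)).
  have [w [/= e1 e2 g1 g2]] := good_split g e.
  have [w' [/= -> e4 _ _]] := good_split g2 e2.
  rewrite e4 in e1; have [v [/= -> e6 _ g6]] := good_split g1 e1.
  have [v1 [/= e7 e8 g7 _]] := good_split g6 e6.
  by have [v2 [/= -> e9 _ _]] := good_split g7 e7; exists v2; rewrite e8 e9.
- split=> [z|x y /= g e] /=.
    rewrite (slide0 p [::] b) (slide0 p [:: I] b).
    rewrite (slide_orth p (a := [:: O, O & b])) //.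
    rewrite (slide_orth p (a := [:: I, I, O & b]) (b := [:: O])) //.
    rewrite (slide_orth p (a := [:: I, O, O & b]) (b := [:: O])) //.
    rewrite (slide0 p [:: O] b) /=.
    by rewrite (slide_orth p (a := [:: O, I, O & b]) (b := [:: I, O, O & b])).
  have [w [/= e1 e2 g1 g2]] := good_split g e.
  have [w1 [/= e3 e4 g3 g4]] := good_split g1 e1.
  have [w2 [/= e5 e6 _ _]] := good_split g4 e4.
  rewrite e6 in e3; have [w3 [/= e7 e8 _ g8]] := good_split g3 e3.
  have [w4 [/= e9 e10 g9 _]] := good_split g8 e8.
  have [v [/= e11 e12 _ _]] := good_split g9 e9.
  exists v; rewrite e7 e2 e5 e10 e11 e12.
  by rewrite (slide_orth p (a := [:: O, I, O & b]) (b := [:: I, O, O & b])).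
Qed.

Lemma cubes_root_1_IO b : cubes p [::] [:: I] [:: I, O & b].
Proof.
apply: (@triple p [::] [:: I] [:: I, O & b]
  [:: [:: O, O, I & b]; [:: I, O, I & b]]
  [:: [:: I]; [::]] [:: [::]; [:: I]; [:: O]]); last exact: join_light_1.
- split=> [z|x y /= g e] /=.
    by rewrite (slide_orth p (a := [:: O, I & b])) // (slide0 p [::] (I :: b)).
  have [w [/= e1 e2 g1 g2]] := good_split g e.
  by have [v [/= -> e4 _ _]] := good_split g1 e1; exists v; rewrite e2 e4.
- split=> [z|x y /= g e] /=.
    rewrite (slide11 p [::] (O :: b)) (slide10 p [::] (O :: b)).
    rewrite (slide10 p [:: I] b) /= (slide_orth p (a := [:: O, I, O & b])) //.
    rewrite (slide_orth p (a := [:: I, O, I & b]) (b := [:: O])) //.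
    by rewrite (slide10 p [:: O] b).
  have [w [/= e1 e2 g1 g2]] := good_split g e.
  have [w2 [/= e3 e4 _ _]] := good_split g2 e2.
  rewrite e4 in e1; have [w3 [/= e5 e6 g5 g6]] := good_split g1 e1.
  have [w4 [/= e7 e8 _ _]] := good_split g6 e6.
  rewrite e8 in e5; have [w5 [/= e9 e10 _ g10]] := good_split g5 e5.
  have [v [/= e11 e12 _ _]] := good_split g10 e10.
  by exists v; rewrite e9 e12 e3 e7 e11.
Qed.

Lemma cubes_root_1_IIO b : cubes p [::] [:: I] [:: I, I, O & b].
Proof.
apply: (@triple p [::] [:: I] [:: I, I, O & b] [:: [:: O, I, I & b]]
  [:: [:: I]; [::]] [:: [::]; [:: I]; [:: O]]); last exact: join_light_1.
- split=> [z|x y /= g e] /=.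
    by rewrite (slide10 p [:: I] b) (slide10 p [::] (I :: b)).
  have [w [/= e1 e2 g1 g2]] := good_split g e.
  by have [v [/= -> e4 _ _]] := good_split g1 e1; exists v; rewrite e2 e4.
- split=> [z|x y /= g e] /=.
    rewrite (slide10 p [::] (I :: b)) (slide_orth p (a := [:: O, I, I & b])) //.
    by rewrite (slide11 p [:: O] b).
  have [w [/= e1 e2 g1 g2]] := good_split g e.
  have [w1 [/= e3 e4 g3 _]] := good_split g1 e1.
  by have [v [/= -> e6 _ _]] := good_split g3 e3; exists v; rewrite e2 e4 e6.
Qed.

Lemma cubes_root_1_III b : cubes p [::] [:: I] [:: I, I, I & b].
Proof.
apply: (@triple p [::] [:: I] [:: I, I, I & b] [:: [:: I, I, I & b]]
  [:: [:: I]; [::]] [:: [::]; [:: I]; [:: O]]); last exact: join_light_1.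
- split=> [z|x y /= g e] /=.
    by rewrite (slide11 p [:: I] b) (slide11 p [::] (I :: b)).
  have [w [/= e1 e2 g1 g2]] := good_split g e.
  by have [v [/= -> e4 _ _]] := good_split g1 e1; exists v; rewrite e2 e4.
- split=> [z|x y /= g e] /=.
    rewrite (slide11 p [::] (I :: b)) (slide11 p [:: I] b).
    by rewrite (slide_orth p (a := [:: I, I, I & b])).
  have [w [/= e1 e2 g1 g2]] := good_split g e.
  have [w1 [/= e3 e4 g3 _]] := good_split g1 e1.
  by have [v [/= -> e6 _ _]] := good_split g3 e3; exists v; rewrite e2 e4 e6.
Qed.

(** The LD relations overlap: they tie p to p1 and p1 to p11, and a further one arises at p0. The
    three words complete the pairwise lcms to the lcm of the three letters. *)
Lemma cubes_root_1_II : cubes p [::] [:: I] [:: I; I].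
Proof.
have oOI z : L [:: O] * (L [:: I] * z) = L [:: I] * (L [:: O] * z).
  by rewrite slide_orth.
have oOII z : L [:: O] * (L [:: I; I] * z) = L [:: I; I] * (L [:: O] * z).
  by rewrite slide_orth.
have oOIO z : L [:: O] * (L [:: I; O] * z) = L [:: I; O] * (L [:: O] * z).
  by rewrite slide_orth.
have oOII' z : L [:: O; I] * (L [:: I] * z) = L [:: I] * (L [:: O; I] * z).
  by rewrite slide_orth.
have o01 c d z : L [:: O, c & d] * (L [:: I; O] * z) =
    L [:: I; O] * (L [:: O, c & d] * z) by rewrite slide_orth.
have o01' c d z : L [:: O, c & d] * (L [:: I; I] * z) =
    L [:: I; I] * (L [:: O, c & d] * z) by rewrite slide_orth.
apply: (@triple p [::] [:: I] [:: I; I] [:: [:: I; I]; [:: I]; [::]]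
  [:: [:: I]; [:: I; I]; [:: I; O]; [::]; [:: I]; [:: O]]
  [:: [::]; [:: I]; [:: O]; [:: I; I]; [:: O; I]; [:: O; O]; [:: I; O]]).
- split=> [z|x y /= g e] /=.
    by rewrite -(slide11 p [::] [::]) (slideLD p [::]) (slideLD p [:: I]).
  have [w [/= e1 e2 g1 g2]] := good_split g e.
  have [v [/= e3 e4 _ g4]] := good_split g1 e1.
  have [v' [/= e5 e6 _ _]] := good_split g4 e4.
  by exists v'; rewrite e3 e2 e5 e6.
- split=> [z|x y /= g e] /=.
    rewrite oOII oOI (slideLD p [:: I]) /=.
    rewrite (slide0 p [::] [::]) (slide10 p [::] [::]) (slide11 p [::] [::]) /=.
    by rewrite -(slide11 p [::] [::]) (slideLD p [::]).
  have [w [/= e1 e2 g1 g2]] := good_split g e.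
  have [v [/= e3 e4 _ g4]] := good_split g2 e2.
  rewrite e4 in e1; have [q [/= e5 e6 g5 g6]] := good_split g1 e1.
  have g4' : good (L [:: I] * (L [::] * v)) by rewrite -e4.
  (* The same letter D_(p1) starts both sides; goodness is what permits cancelling it before left
     cancellation is known. *)
  have e7 := cancel_good g4' e6.
  have [q1 [/= e8 e9 _ g9]] := good_split (good_tl g4') e7.
  have [q2 [/= e10 e11 _ _]] := good_split g9 e9.
  rewrite e10 in e5; have [x' [/= e12 e13 _ g13]] := good_split g5 e5.
  have [x2 [/= e14 e15 g14 _]] := good_split g13 e13.
  have [s [/= e16 e17 _ _]] := good_split g14 e14.
  by exists s; rewrite e12 e15 e17 e3 e8 e11 e16.
- split=> [z|x y /= g e] /=.
    rewrite !(slide10 p [::] [::]) !(slide11 p [::] [::]) /= !oOII' !oOII !o01'.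
    rewrite !o01 !oOIO !o01 -(slideLD p [:: I]) -(slideLD p [:: O]) /=.
    by rewrite -oOI -oOII -(slideLD p [::]).
  have [w [/= e1 e2 g1 g2]] := good_split g e.
  have [w1 [/= e3 e4 g3 g4]] := good_split g2 e2.
  have [z0 [/= e5 e6 _ _]] := good_split g3 e3.
  rewrite e6 in e4; have [q [/= e7 e8 g7 g8]] := good_split g4 e4.
  have [w' [/= e9 e10 _ g10]] := good_split g7 e7.
  have [q' [/= e11 e12 _ _]] := good_split g10 e10.
  rewrite e11 in e8; have [z1 [/= e13 e14 _ g14]] := good_split g8 e8.
  have [z2 [/= e15 e16 g15 _]] := good_split g14 e14.
  have [z3 [/= e17 e18 g17 _]] := good_split g15 e15.
  have [s [/= e19 e20 _ _]] := good_split g17 e17.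
  exists s; rewrite e1 e9 e12 e19 e5 e13 e16 e18 e20.
  rewrite (slide10 p [::] [::]) (slide11 p [::] [::]) /= oOII'; split=> //.
  by rewrite !o01 oOII oOIO.
Qed.

Lemma cubes_root_1 b : light b -> cubes p [::] [:: I] b.
Proof.
case/lightP=> {}b; first exact: cubes_root_1_O; first exact: cubes_root_1_IO.
case: b => [|[] b]; first exact: cubes_root_1_II.
- exact: cubes_root_1_III.
- exact: cubes_root_1_IIO.
Qed.

Lemma cubes_perp x a b c : cubes p (x :: a) (x :: b) (~~ x :: c).
Proof.
have o d e : orth (x :: d) (~~ x :: e) by case: x.
have xx : x != ~~ x by case: (x).
have jo d e : join_compl p (x :: d) (x :: e) (~~ x :: c) [:: ~~ x :: c]
    (compl (x :: d) (x :: e)).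
  rewrite -(compl_neq d c xx); apply: join_orth.
  rewrite compl_neq // compl_cons all_map; apply/allP => f _.
  by rewrite /= andbT; apply: o.
apply: (triple (jo _ _) (jo _ _)).
rewrite !compl_cons; apply: (join_shift (q := [:: x]));
  by rewrite compl_neq // eq_sym.
Qed.

Lemma cubes_rot a b c : cubes p a b c -> cubes p b c a.
Proof. by case=> abc acb bca; split=> //; apply: cube_sym. Qed.

Lemma cubes_swap a b c : cubes p a b c -> cubes p b a c.
Proof. by case=> abc acb bca; split=> //; apply: cube_sym. Qed.

Lemma cubes_root b c : b != [::] -> c != [::] -> cubes p [::] b c.
Proof.
have lightN d : d != [::] -> light d \/ d = [:: I].
  by case: d => [|[] [|? ?]] //; [right|left|left|left].
move=> /lightN[lb|->] /lightN[lc|->].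
- exact/cubes_rot/cubes_rot/cubes_root_light.
- exact/cubes_rot/cubes_swap/cubes_root_1.
- exact: cubes_root_1.
- by split; [exact: cube_eq23 | exact: cube_eq23 | exact: cube_eq12].
Qed.

End Cube.

Lemma cube_cons p x a b c :
  cube (rcons p x) a b c -> cube p (x :: a) (x :: b) (x :: c).
Proof.
move=> abc u v; rewrite !compl_cons !lact_map1 => g /(abc _ _ g)[r [e1 e2]].
by exists r; rewrite !lact_map1.
Qed.

(** After common first digits are stripped, either some letter sits at the root, or two addresses
    share their first digit and the third lies on the other side. *)
Lemma all_cubes p a b c : cubes p a b c.
Proof.
elim: a b c p => [|x a IH] b c p.
  have [->|b0] := eqVneq b [::].
    by split; [exact: cube_eq12 | exact: cube_eq13 | exact: cube_eq13].
  have [->|c0] := eqVneq c [::]; last exact: cubes_root.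
  by split; [exact: cube_eq13 | exact: cube_eq12 | exact: cube_eq23].
case: b => [|y b].
  have [->|c0] := eqVneq c [::]; last exact/cubes_swap/cubes_root.
  by split; [exact: cube_eq23 | exact: cube_eq23 | exact: cube_eq12].
case: c => [|z c]; first exact/cubes_rot/cubes_root.
have neqN u v : u != v -> v = ~~ u by case: u v => [] [].
have [<-|xy] := eqVneq x y.
  have [<-|xz] := eqVneq x z; last by rewrite (neqN _ _ xz); exact: cubes_perp.
  by have [? ? ?] := IH b c (rcons p x); split; apply: cube_cons.
have [xz|xz] := eqVneq x z.
  rewrite -xz (neqN _ _ xy); exact/cubes_rot/cubes_swap/cubes_perp.
rewrite (neqN _ _ xz) (neqN _ _ xy) -{1}(negbK x).
exact/cubes_rot/cubes_rot/cubes_perp.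
Qed.

(** * Left cancellation and right lcms *)

Lemma LDcong_nil w w' : LDcong w w' -> (w == [::]) = (w' == [::]).
Proof.
elim=> {w w'} [u v w w' /LDrel_compl[a [b [-> ->]]]|//|//|w w' w'' _ -> _ -> //].
by case: u.
Qed.

(** Induction on the derivation. A relation applied beyond the first letter leaves that letter in
    place, and transitivity through a word starting with c is the cube condition at c, which calls
    for goodness of proper right divisors only. *)
Lemma split_chain w w' : LDcong w w' ->
  (forall m, tail_of m (\pi_LDplus w) -> good m) ->
  forall a u b v, w = a :: u -> w' = b :: v ->
  exists x, \pi_LDplus u = lact [::] (compl a b) x /\
            \pi_LDplus v = lact [::] (compl b a) x.
Proof.
elim=> {w w'} [u v w w' /[dup] ww' /LDrel_compl[c [d [ew ew']]]|w|w w' ww' IH|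
               w w' w'' ww' IH1 w'w'' IH2] gd a u1 b v1.
- rewrite ew ew'; case: u gd => [|e u] _ [<- <-] [<- <-].
    by exists (\pi_LDplus v); rewrite !lact_nil !pi_cat.
  exists (\pi_LDplus (u ++ w ++ v)); rewrite compl_id; split; first by rewrite ew.
  by apply/LDpi_eq/LDcong_sym; have := LDcong_rel u v ww'; rewrite ew'.
- move=> -> [<- <-]; exists (\pi_LDplus u1); rewrite compl_id; split=> //.
- move=> ew ew'; have e : \pi_LDplus w' = \pi_LDplus w by apply/LDpi_eq/LDcong_sym.
  by have [|x [? ?]] := IH _ b v1 a u1 ew' ew; [rewrite -e | exists x].
- move=> ew ew''.
  (* The intermediate word must have a first letter for the cube condition to apply to it. *)
  have : (w == [::]) = (w' == [::]) := LDcong_nil ww'.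
  rewrite ew; case ew': w' => [//|c z] _.
  have e : \pi_LDplus w = \pi_LDplus w' by apply/LDpi_eq.
  have [x1 [e1 e2]] := IH1 gd _ _ _ _ ew ew'.
  have gd' m : tail_of m (\pi_LDplus w') -> good m by rewrite -e; apply: gd.
  have [x2 [e3 e4]] := IH2 gd' _ _ _ _ ew' ew''.
  have gz : good (\pi_LDplus z) by apply: gd'; exists c; rewrite ew' pi_cons.
  rewrite e2 in e3 gz.
  have [cab _ _] := all_cubes [::] a b c.
  by have [r [e5 e6]] := cab _ _ gz e3; exists r; rewrite e1 e4.
Qed.

Lemma all_good m : good m.
Proof.
elim/(well_founded_ind tail_wf): m => m IH u v em.
case: (LD_case u) em => [->|[a [u' ->]]]; last first.
  by rewrite -mulgA => em; apply: (IH (u' * v)) erefl; exists a.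
rewrite mul1g => <- {u v} a b; elim/LDplusW=> u; elim/LDplusW=> v eu ev.
apply: (split_chain _ _ erefl erefl).
  by apply/LDpi_eq; rewrite !pi_cons -eu.
by rewrite pi_cons -eu.
Qed.

Lemma LDmulI : right_injective (@mul LDplus).
Proof.
move=> m u v; elim/LD_ind: m => [|a m IH]; first by rewrite !mul1g.
rewrite -!mulgA => e; apply: IH.
exact: (@cancel_good [::] a _ _ (@all_good _) e).
Qed.

Lemma D_split a b u v : D a * u = D b * v ->
  exists w, u = lact [::] (compl a b) w /\ v = lact [::] (compl b a) w.
Proof.
by move=> e; have [w [-> -> _ _]] := @good_split [::] a b _ _ (@all_good _) e; exists w.
Qed.

Definition is_lcm (u v c d : LDplus) : Prop := u * c = v * d /\
  forall x y, u * x = v * y -> exists w, x = c * w /\ y = d * w.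

(** The factor [c] makes room for the cofactor of D_a C(a,b), which lies several letters to the
    right. *)
Definition strict_tail_of (m' m : LDplus) := exists a c, m = D a * (c * m').

Lemma strict_tail_wf : well_founded strict_tail_of.
Proof.
suff H m c m' : m = c * m' -> Acc strict_tail_of m'.
  by move=> m; apply: (H m 1); rewrite mul1g.
elim/(well_founded_ind tail_wf): m c m' => m IH c m' em.
constructor=> m'' [a [d em']]; move: em; rewrite em'.
case: (LD_case c) => [->|[b [c' ->]]]; rewrite ?mul1g -?mulgA => em.
  by apply: (IH (d * m'')) erefl; exists a.
apply: (IH (c' * (D a * (d * m''))) _ (c' * D a * d)); first by exists b.
by rewrite !mulgA.
Qed.

(** Induction on the common multiple, by filling a two-by-two grid: the defining relation of the
    first letters is one corner, and the other three squares are lcms inside proper right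
    divisors. *)
Lemma lcm_exists u v x y : u * x = v * y -> exists c d, is_lcm u v c d.
Proof.
move em : (u * x) => m; elim/(well_founded_ind strict_tail_wf): m u v x y em.
move=> m IH u v x y eu ev.
case: (LD_case u) eu => [-> _|[a [u' ->]] eu].
  exists v, 1; split=> [|x' y' e]; first by rewrite mul1g mulg1.
  by exists y'; rewrite mul1g -e mul1g.
case: (LD_case v) ev => [-> _|[b [v' ->]] ev].
  exists 1, (D a * u'); split=> [|x' y' e]; first by rewrite mul1g mulg1.
  by exists x'; rewrite mul1g e mul1g.
have e0 : D a * (u' * x) = D b * (v' * y) by rewrite !mulgA eu -ev.
have [m2 [e1 e2]] := D_split e0.
have e3 : m = D a * (1 * (u' * x)) by rewrite mul1g mulgA eu.
have e4 : m = D b * (1 * (v' * y)) by rewrite mul1g mulgA -ev.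
set A := \pi_LDplus (compl a b); set B := \pi_LDplus (compl b a).
have AB z : D a * (A * z) = D b * (B * z).
  by rewrite -!lact_nil; apply: (lact_compl [::]).
rewrite lact_nil -/A in e1; rewrite lact_nil -/B in e2.
have e5 : m = D a * (A * m2) by rewrite -e1 e3 mul1g.
have [p [q [epq Hpq]]] :=
  IH _ (ex_intro _ a (ex_intro _ 1 e3)) _ _ _ _ erefl e1.
have [p' [q' [epq' Hpq']]] :=
  IH _ (ex_intro _ b (ex_intro _ 1 e4)) _ _ _ _ erefl e2.
have [z [_ ez]] := Hpq _ _ e1; have [z' [_ ez']] := Hpq' _ _ e2.
have [r [r' [er Hr]]] :=
  IH _ (ex_intro _ a (ex_intro _ A e5)) _ _ _ _ (esym ez) ez'.
exists (p * r), (p' * r'); split=> [|x' y' e].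
  rewrite -!mulgA (mulgA u') (mulgA v') epq epq' -!mulgA er.
  exact: AB.
rewrite -!mulgA in e; have [n [e1' e2']] := D_split e.
rewrite lact_nil -/A in e1'; rewrite lact_nil -/B in e2'.
have [y1 [ex1 en]] := Hpq _ _ e1'; have [y2 [ex2 en']] := Hpq' _ _ e2'.
rewrite en' in en; have [w [ey2 ey1]] := Hr _ _ (esym en).
by exists w; rewrite ex1 ex2 ey1 ey2 !mulgA.
Qed.

(** * The Garside map *)

Lemma LDmul_ext (x y : LDplus) : (forall z, x * z = y * z) -> x = y.
Proof. by move/(_ 1); rewrite !mulg1. Qed.

Lemma mulg_tail (x y u v : LDplus) :
  x * y = u * v -> forall z, x * (y * z) = u * (v * z).
Proof. by move=> e z; rewrite mulgA e -mulgA. Qed.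

Lemma sh1 c : sh c 1 = 1.
Proof. exact: gmulf1. Qed.

Lemma shM c a b : sh c (a * b) = sh c a * sh c b.
Proof. exact: gmulfM. Qed.

Lemma sh_D c a : sh c (D a) = D (c ++ a).
Proof. by rewrite sh_pi. Qed.

Lemma sh_sh c d a : sh c (sh d a) = sh (c ++ d) a.
Proof.
elim/LD_ind: a => [|a m IH]; first by rewrite !sh1.
by rewrite !shM !sh_D IH catA.
Qed.

Lemma orth_catl a b c : orth a b -> orth a (b ++ c).
Proof. by elim: a b => [|[] a IH] [|[] b] //=; apply: IH. Qed.

Lemma sh_orthD q a r b z : orth q r ->
  D (q ++ a) * (sh r b * z) = sh r b * (D (q ++ a) * z).
Proof.
move=> qr; elim/LD_ind: b => [|b m IH]; first by rewrite sh1 !mul1g.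
rewrite shM sh_D -!mulgA -IH; apply: (slide_orth [::]).
by apply: orth_catl; rewrite orth_sym; apply: orth_catl; rewrite orth_sym.
Qed.

Lemma sh_orth q a r b z : orth q r ->
  sh q a * (sh r b * z) = sh r b * (sh q a * z).
Proof.
move=> qr; elim/LD_ind: a => [|a m IH]; first by rewrite sh1 !mul1g.
by rewrite shM sh_D -!mulgA IH sh_orthD.
Qed.

Lemma sh_slide0 a z : sh [:: false] a * (D [::] * z) =
  D [::] * (sh [:: false; false] a * (sh [:: true; false] a * z)).
Proof.
elim/LD_ind: a z => [|a m IH] z; first by rewrite !sh1 !mul1g.
rewrite !shM !sh_D -!mulgA IH; have /= -> := slide0 [::] [::] a.
by rewrite -(sh_orthD (q := [:: true; false])).
Qed.

Lemma sh_slide10 a z : sh [:: true; false] a * (D [::] * z) =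
  D [::] * (sh [:: false; true] a * z).
Proof.
elim/LD_ind: a z => [|a m IH] z; first by rewrite !sh1 !mul1g.
by rewrite !shM !sh_D -!mulgA IH; have /= -> := slide10 [::] [::] a.
Qed.

Lemma sh_slide11 a z : sh [:: true; true] a * (D [::] * z) =
  D [::] * (sh [:: true; true] a * z).
Proof.
elim/LD_ind: a z => [|a m IH] z; first by rewrite !sh1 !mul1g.
by rewrite !shM !sh_D -!mulgA IH; have /= -> := slide11 [::] [::] a.
Qed.

Lemma sh01C a b z : sh [:: false] a * (sh [:: true] b * z) =
  sh [:: true] b * (sh [:: false] a * z).
Proof. exact: sh_orth. Qed.

(** [delta s] distributes a left factor over the leaves of s and keeps the inner shape of s, so
    expanding s beforehand or expanding the result at the same address [g] agree. At the root this
    is the LD relation. *)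
Lemma delta_slide_D s g s' : act s (D g) = Some s' ->
  sh [:: true] (D g) * delta s' = delta s * D g.
Proof.
rewrite act_D; elim: g s s' => [|[] g IH] [i|s1 s2] s' //=.
- case: s2 => [//|s2 s3] [<-] /=; apply: LDmul_ext => z.
  rewrite !shM !sh_D !sh_sh /= -!mulgA.
  rewrite sh_slide11 sh_slide10.
  rewrite -(sh_orthD [::] _ _ (q := [:: true]) (r := [:: false])) //.
  rewrite sh_slide0; have /= -> := slideLD [::] [::].
  rewrite -(sh_orthD [::] _ _ (q := [:: true]) (r := [:: false; true])) //.
  rewrite -(sh_orthD [::] _ _ (q := [:: true]) (r := [:: false; false])) //.
  have /= -> // := slide_orth [::] (a := [:: false]) (b := [:: true]).
  by rewrite (sh_orth _ _ _ (q := [:: true; false]) (r := [:: false; true])).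
- case E: (actD s2 g) => [s|] //= [<-] /=; apply: LDmul_ext => z.
  rewrite -!mulgA sh_D /=; have /= -> := slide11 [::] [::] g.
  rewrite (sh_orthD _ _ _ (q := [:: true])) //.
  have := IH _ _ E; rewrite sh_D => /(congr1 (sh [:: true])).
  by rewrite !shM !sh_D /= => e; rewrite !mulgA -(mulgA _ (D _)) e !mulgA.
- case E: (actD s1 g) => [s|] //= [<-] /=; apply: LDmul_ext => z.
  rewrite -!mulgA sh_D /=; have /= -> := slide10 [::] [::] g.
  have := IH _ _ E; rewrite sh_D => /(congr1 (sh [:: false])).
  rewrite !shM !sh_D /= => e; rewrite (mulgA (D (false :: _))) e.
  by rewrite -!mulgA (sh_orthD _ _ _ (q := [:: false])).
Qed.

Lemma delta_slide s b s' : act s b = Some s' ->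
  sh [:: true] b * delta s' = delta s * b.
Proof.
elim/LD_ind: b s => [|a m IH] s; first by rewrite act1 sh1 mul1g mulg1 => -[->].
move=> /act_Some[s1 /delta_slide_D e1 /IH e2].
by rewrite shM -mulgA e2 !mulgA e1.
Qed.

(** The left factor is copied to every leaf of s, so [b'] is a product of shifted copies of [b], one
    for each leaf. *)
Lemma delta_slide0 s b : exists b', sh [:: false] b * delta s = delta s * b'.
Proof.
elim: s b => [i|s0 IH0 s1 IH1] b /=.
  by exists (sh [:: false] b); rewrite mul1g mulg1.
have [b0 e0] := IH0 b; have [b1 e1] := IH1 b.
exists (sh [:: false] b0 * sh [:: true] b1); apply: LDmul_ext => z.
have /(congr1 (sh [:: false])) := e0; have /(congr1 (sh [:: true])) := e1.
rewrite !shM !sh_sh /= => /mulg_tail {}e1 /mulg_tail {}e0.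
rewrite -!mulgA sh_slide0 (sh_orth _ _ _ (q := [:: true; false])) //.
by rewrite e0 e1 -[in RHS]sh01C.
Qed.

Lemma delta_distr p q : exists x, delta (distr p q) = delta q * x.
Proof.
elim: q => [i|q0 [x0 e0] q1 [x1 e1]] /=; first by eexists; rewrite mul1g.
exists (sh [:: false] x0 * sh [:: true] x1); rewrite e0 e1.
by apply: LDmul_ext => z; rewrite !shM -!mulgA sh01C.
Qed.

(** Sliding the inner [delta] to the end brings forward [delta (phi t1 ⋆ phi t2)], which starts with
    the root letter; this form serves every computation with D at the root. *)
Lemma DeltaLD_root t0 t1 t2 : DeltaLD (t0 ⋆ (t1 ⋆ t2)) =
  sh [:: false] (DeltaLD t0) * sh [:: true; false] (DeltaLD t1) *
  sh [:: true; true] (DeltaLD t2) * delta (phi t1 ⋆ phi t2) * delta (phi t2).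
Proof.
rewrite -[RHS]mulgA -(delta_slide (act_delta _ _)).
by rewrite /= !shM !sh_sh !mulgA.
Qed.

Lemma DeltaLD_mul_D t a t' : act t (D a) = Some t' ->
  exists b, D a * DeltaLD t' = DeltaLD t * b.
Proof.
rewrite act_D; elim: a t t' => [|[] a IH] [i|t0 t1] t' //=.
- case: t1 => [//|t1 t2] [<-]; have [x ex] := delta_distr (phi t0) (phi t2).
  exists x; have /= -> := DeltaLD_root t0 t1 t2; apply: LDmul_ext => z.
  rewrite ex !shM !sh_sh /= -!mulgA.
  rewrite sh_slide11 sh_slide10 sh_slide0.
  rewrite (sh_orth _ _ _ (q := [:: false]) (r := [:: true; false])) //.
  rewrite (sh_orth _ _ _ (q := [:: false]) (r := [:: true; true])) //.
  by rewrite (sh_orth _ _ _ (q := [:: false; true]) (r := [:: true; false])).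
- case E: (actD t1 a) => [s|] //= [<-] /=; have [b /[dup] e] := IH _ _ E.
  move=> /(congr1 (sh [:: true])); rewrite !shM sh_D => /mulg_tail e'.
  have act_b : act (phi t1) b = Some (phi s).
    have /eqP := act_Delta s; rewrite -[in X in X -> _](act_comp _ (t := t1) (m := D a)) ?act_D //.
    by rewrite e (act_comp _ (eqP (act_Delta t1))).
  exists b; apply: LDmul_ext => z; rewrite -!mulgA.
  rewrite (sh_orthD a _ _ (q := [:: true]) (r := [:: false])) // e'.
  by rewrite (mulgA (sh _ b)) (delta_slide act_b) -!mulgA.
- case E: (actD t0 a) => [s|] //= [<-] /=; have [b e] := IH _ _ E.
  have [b' e'] := delta_slide0 (phi t1) b; exists b'.
  apply: LDmul_ext => z; rewrite -!mulgA.
  move: e => /(congr1 (sh [:: false])); rewrite !shM sh_D => /mulg_tail -> .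
  by rewrite sh01C (mulg_tail e').
Qed.

Lemma D_dvd_DeltaLD t a t' : act t (D a) = Some t' ->
  exists d, DeltaLD t = D a * d.
Proof.
rewrite act_D; elim: a t t' => [|[] a IH] [i|t0 t1] t' //=.
- case: t1 => [//|t1 t2] _; have /= -> := DeltaLD_root t0 t1 t2.
  eexists; rewrite -!mulgA sh_slide11 sh_slide10 sh_slide0; reflexivity.
- case E: (actD t1 a) => [s|] //= _; have [d ->] := IH _ _ E.
  eexists; rewrite -!mulgA shM sh_D -mulgA.
  by rewrite -(sh_orthD a _ _ (q := [:: true]) (r := [:: false])).
- case E: (actD t0 a) => [s|] //= _; have [d ->] := IH _ _ E.
  by eexists; rewrite -!mulgA shM sh_D -mulgA.
Qed.

Lemma act_DeltaE t : act t (DeltaLD t) = Some (phi t).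
Proof. exact/eqP/act_Delta. Qed.

Lemma DeltaLD_mul t a t' : act t a = Some t' ->
  exists b, a * DeltaLD t' = DeltaLD t * b.
Proof.
elim/LD_ind: a t => [|a m IH] t.
  by rewrite act1 => -[->]; exists 1; rewrite mul1g mulg1.
case/act_Some=> t1 /DeltaLD_mul_D[b eb] /IH[b' eb'].
by exists (b * b'); rewrite -mulgA eb' !mulgA eb.
Qed.

Lemma Phi_subproof t a : exists b : LDplus,
  forall t', act t a = Some t' -> a * DeltaLD t' = DeltaLD t * b.
Proof.
case E: (act t a) => [t'|]; last by exists 1.
by have [b eb] := DeltaLD_mul E; exists b => _ [<-].
Qed.

(* The associated functor on the morphism (t, a, t•a); arbitrary if t•a is
   undefined. *)
Definition Phi t a : LDplus := sval (cid (Phi_subproof t a)).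

Lemma PhiP t a t' : act t a = Some t' -> a * DeltaLD t' = DeltaLD t * Phi t a.
Proof. by rewrite /Phi; case: cid => b /= eb /eb. Qed.

Lemma Phi_uniq t a t' b : act t a = Some t' ->
  a * DeltaLD t' = DeltaLD t * b -> Phi t a = b.
Proof. by move=> /PhiP -> /LDmulI. Qed.

Lemma Phi1 t : Phi t 1 = 1.
Proof. by apply: Phi_uniq (act1 t) _; rewrite mul1g mulg1. Qed.

Lemma PhiM t a t' b : act t a = Some t' -> isSome (act t' b) ->
  Phi t (a * b) = Phi t a * Phi t' b.
Proof.
move=> ta; case tb: (act t' b) => [t2|] // _.
apply: (@Phi_uniq _ _ t2); first by rewrite (act_comp _ ta).
by rewrite -mulgA (PhiP tb) !mulgA (PhiP ta).
Qed.

Lemma act_Phi t a t' : act t a = Some t' -> act (phi t) (Phi t a) = Some (phi t').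
Proof.
move=> ta; rewrite -(act_comp _ (act_DeltaE t)) -(PhiP ta).
by rewrite (act_comp _ ta) act_DeltaE.
Qed.

Definition dvd (a b : LDplus) : Prop := exists c, a * c = b.

Lemma dvd_trans a b c : dvd a b -> dvd b c -> dvd a c.
Proof. by move=> [x <-] [y <-]; exists (x * y); rewrite mulgA. Qed.

Lemma dvd_mull a b c : dvd (a * b) (a * c) <-> dvd b c.
Proof.
split=> [[x]|[x <-]]; first by rewrite -mulgA => /LDmulI <-; exists x.
by exists x; rewrite mulgA.
Qed.

Lemma dvd_mulr a b : dvd a (a * b).
Proof. by exists b. Qed.

Lemma LD_mul_eq1 (a b : LDplus) : a * b = 1 -> a = 1.
Proof.
move=> ab; have := act1 (Var 0); rewrite -[X in act _ X]ab.
case/act_Some=> t' ta tb; apply: (act_same_tsize ta); apply/eqP.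
by rewrite eqn_leq (act_tsize ta) (act_tsize tb).
Qed.

Lemma dvd_anti a b : dvd a b -> dvd b a -> a = b.
Proof.
move=> [x ax] [y]; rewrite -ax -mulgA -[RHS]mulg1 => /LDmulI /LD_mul_eq1 ->.
by rewrite mulg1.
Qed.

(** * Simple elements and common multiples at a term *)

Definition simple_at t s : Prop := dvd s (DeltaLD t).

Lemma simple_act t s : simple_at t s -> exists t', act t s = Some t'.
Proof.
case=> x sx; have := act_DeltaE t; rewrite -sx => /act_Some[t' ? _].
by exists t'.
Qed.

Lemma D_simple t a t' : act t (D a) = Some t' -> simple_at t (D a).
Proof. by case/D_dvd_DeltaLD=> d e; exists d. Qed.

Lemma simple1 t : simple_at t 1.
Proof. by exists (DeltaLD t); rewrite mul1g. Qed.

Lemma simple_star t s t' s' : act t s = Some t' -> s * s' = DeltaLD t ->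
  s' * Phi t s = DeltaLD t'.
Proof.
move=> ts ss'; apply: (@LDmulI s); rewrite /= mulgA ss'.
by rewrite (PhiP ts).
Qed.

Lemma simple_Phi t s : simple_at t s -> simple_at (phi t) (Phi t s).
Proof.
move=> /[dup] /simple_act[t' ts] [s' ss'].
have ts' : act t' s' = Some (phi t).
  by rewrite -(act_comp _ ts) ss' act_DeltaE.
have := simple_star ts ss' => e; have e' := simple_star ts' e.
by exists (Phi t' s').
Qed.

(** The element f Delta(t') = Delta(t) phi(f) is a multiple of both s and f, hence of their lcm;
    cancelling f on the left leaves Delta(t'). *)
Lemma simple_residue t s f t' c d : simple_at t s -> act t f = Some t' ->
  is_lcm s f c d -> simple_at t' d.
Proof.
move=> [s' ss'] tf [_ lcmP]; have := PhiP tf.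
rewrite -ss' -mulgA => /esym /lcmP[w [_ e]].
by exists w.
Qed.

(** By f Delta(t•f) = Delta(t) phi(f), each letter applicable at t has a common multiple with f that
    is still defined at t; this is repeated along the letters of g. *)
Lemma common_multiple_at t f g : isSome (act t f) -> isSome (act t g) ->
  exists x y, f * x = g * y /\ isSome (act t (f * x)).
Proof.
elim/LD_ind: g t f => [|a g IH] t f tf tg.
  by exists 1, f; rewrite mul1g mulg1.
case E: (act t (D a * g)) tg => [t2|] // _.
have [t1 ta t1g] := act_Some E.
case tf' : (act t f) tf => [t'|] // _.
have [d ed] := D_simple ta.
have e : f * DeltaLD t' = D a * (d * Phi t f) by rewrite (PhiP tf') -ed mulgA.
have [| |x [y [exy dxy]]] := IH t1 (d * Phi t f).
- rewrite -(act_comp _ ta) -e (act_comp _ tf') act_DeltaE //.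
- by rewrite t1g.
exists (DeltaLD t' * x), y; rewrite mulgA e -(mulgA (D a)).
by split; [rewrite exy mulgA | rewrite (act_comp _ ta)].
Qed.

Lemma lcm_total f g : exists c d, is_lcm f g c d.
Proof.
have [t [t1 [t2 [e1 e2]]]] := act_common_term f g.
have [||x [y [e _]]] := @common_multiple_at t f g; rewrite ?e1 ?e2 //.
exact: lcm_exists e.
Qed.

(** * Simple elements are determined by their targets *)

Fixpoint leaves (t : term) : seq nat :=
  match t with Var i => [:: i] | t1 ⋆ t2 => leaves t1 ++ leaves t2 end.

Fixpoint varR (t : term) : nat :=
  match t with Var i => i | _ ⋆ t2 => varR t2 end.

Lemma varR_leaves t : varR t \in leaves t.
Proof. by elim: t => [i|t1 _ t2 IH] /=; rewrite ?mem_head // mem_cat IH orbT. Qed.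

Definition increasing (t : term) : bool := pairwise ltn (leaves t).

(* [ordered] is inherited backwards along LD-expansions and holds for phi t when
   t is increasing, hence for the target of every simple element at t. *)
Fixpoint ordered (t : term) : bool :=
  match t with
  | Var _ => true
  | u ⋆ v => [&& (varR u < varR v)%N, ordered u & ordered v]
  end.

Lemma varR_actD t a t' : actD t a = Some t' -> varR t' = varR t.
Proof.
elim: a t t' => [|[] a IH] [i|t1 t2] t' //=.
- by case: t2 => [//|t2 t3] [<-].
- by case E: (actD t2 a) => [s|] // [<-] /=; apply: IH E.
- by case E: (actD t1 a) => [s|] // [<-].
Qed.

Lemma ordered_actD t a t' : actD t a = Some t' -> ordered t' -> ordered t.
Proof.
elim: a t t' => [|[] a IH] [i|t1 t2] t' //=.
- case: t2 => [//|t2 t3] [<-] /= /and3P[-> /and3P[_ -> ->] /and3P[-> _ ->]] //.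
- case E: (actD t2 a) => [s|] // [<-] /= /and3P[+ -> /(IH _ _ E) ->].
  by rewrite (varR_actD E) => ->.
- case E: (actD t1 a) => [s|] // [<-] /= /and3P[+ /(IH _ _ E) -> ->].
  by rewrite (varR_actD E) => ->.
Qed.

Lemma varR_act t a t' : act t a = Some t' -> varR t' = varR t.
Proof.
elim/LD_ind: a t => [|a m IH] t; first by rewrite act1 => -[->].
by case/act_Some=> t1; rewrite act_D => /varR_actD <- /IH.
Qed.

Lemma ordered_act t a t' : act t a = Some t' -> ordered t' -> ordered t.
Proof.
elim/LD_ind: a t => [|a m IH] t; first by rewrite act1 => -[->].
by case/act_Some=> t1; rewrite act_D => /ordered_actD e /IH h /h.
Qed.

(** The product D_(1...1) ... D_1 D_[] of r letters. It maps t1⋆(t2⋆(...)) to a product whose left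
    half is the right comb t1⋆(...⋆t_(r+1)). *)
Fixpoint Dr (r : nat) : LDplus :=
  if r is r'.+1 then sh [:: true] (Dr r') * D [::] else 1.

Lemma DrS r : Dr r.+1 = sh [:: true] (Dr r) * D [::].
Proof. by []. Qed.

(** Sliding the letters below 11 past the root letter exposes an LD relation at the root; the rest
    is the induction hypothesis shifted to the right. *)
Lemma Dr_absorb r r' : (r <= r')%N -> exists y0 y1,
  Dr r * sh [:: true] (Dr r') * D [::] =
  Dr r'.+1 * sh [:: false] y0 * sh [:: true] y1.
Proof.
elim: r r' => [|r IH] r' le_rr'.
  by exists 1, 1; rewrite !sh1 !mulg1 mul1g.
case: r' le_rr' => [//|r'] /IH[y0 [y1]]; rewrite !DrS.
move: (Dr r) (Dr r') => X Y /(congr1 (sh [:: true])) e.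
have {}e z : sh [:: true] X * (sh [:: true; true] Y * (D [:: true] * z)) =
    sh [:: true; true] Y * (D [:: true] *
      (sh [:: true; false] y0 * (sh [:: true; true] y1 * z))).
  by move: e => /(congr1 (fun m => m * z)); rewrite !shM !sh_D !sh_sh -!mulgA.
exists (sh [:: true] y0 * D [::]), (sh [:: true] y1 * D [::]).
apply: LDmul_ext => z; rewrite !shM !sh_D !sh_sh -!mulgA /= -sh_slide11.
have /= -> := slideLD [::] [::]; rewrite e sh_slide11 sh_slide10.
have /= -> // := slide_orth [::] (a := [:: true]) (b := [:: false]).
by rewrite (sh_orthD [::] _ _ (q := [:: false]) (r := [:: true; true])).
Qed.

(** The invariant that recovers r: after [Dr r], this variable is the rightmost one of the left
    half, and in an increasing term it grows strictly with r. *)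
Fixpoint varRn (r : nat) (t : term) : nat :=
  match r, t with
  | 0, t1 ⋆ _ => varR t1
  | r'.+1, _ ⋆ s => varRn r' s
  | _, Var i => i
  end.

Lemma varRn_leaves r t : varRn r t \in leaves t.
Proof.
elim: r t => [|r IH] [i|t1 s] /=; rewrite ?mem_head // mem_cat.
  by rewrite varR_leaves.
by rewrite IH orbT.
Qed.

Lemma act_Var i a t' : act (Var i) a = Some t' -> a = 1 /\ t' = Var i.
Proof.
case: (LD_case a) => [->|[b [m ->]]]; first by rewrite act1 => -[<-].
by case/act_Some=> t1; rewrite act_D; case: b => [|[]].
Qed.

Lemma mulD_neq1 m a : m * D a <> 1.
Proof.
move=> /[dup] /LD_mul_eq1 ->; rewrite mul1g => e.
by have := act1 (Var 0); rewrite -e act_D; case: (a) => [|[]].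
Qed.

(** The subsequence clauses keep both halves increasing, for inductions on subterms; the last clause
    compares a smaller index in [v] with [r] in the original term. *)
Lemma act_Dr r t1 s t' : act (t1 ⋆ s) (Dr r) = Some t' ->
  exists u v, [/\ t' = u ⋆ v, varR u = varRn r (t1 ⋆ s),
    subseq (leaves u) (leaves (t1 ⋆ s)), subseq (leaves v) (leaves (t1 ⋆ s)) &
    forall r', (r' < r)%N -> varRn r' v = varRn r' (t1 ⋆ s)].
Proof.
elim: r t1 s t' => [|r IH] t1 s t'.
  rewrite act1 => -[<-]; exists t1, s; split=> //=.
  - exact: prefix_subseq.
  - exact: suffix_subseq.
rewrite DrS actM act_sh1; case: s => [i|s1 s2].
  case E: (act _ _) => [w|] //=.
  by have [_ ->] := act_Var E; rewrite act_D.
case E: (act _ (Dr r)) => [w|] //=; have [u [v [-> eu su sv vv]]] := IH _ _ _ E.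
rewrite act_D => -[<-]; exists (t1 ⋆ u), (t1 ⋆ v).
split=> //; try exact: cat_subseq.
by case=> [|r'] //; rewrite ltnS => /vv.
Qed.

Lemma varRn_lt r r' t : increasing t -> isSome (act t (Dr r)) -> (r' < r)%N ->
  (varRn r' t < varRn r t)%N.
Proof.
rewrite /increasing; elim: r r' t => [//|r IH] r' [i|t1 s] /=.
  case E: (act _ _) => [w|] // _ _.
  by have [/mulD_neq1] := act_Var E.
rewrite pairwise_cat => /and3P[/allrelP lt_1s _ inc_s]; rewrite actM act_sh1.
case E: (act s (Dr r)) => [w|] //= _; case: r' => [|r'] /= rr'.
  by apply: lt_1s; [apply: varR_leaves | apply: varRn_leaves].
by apply: IH rr' => //; rewrite E.
Qed.

(* A letter D_e following Dr r * sh [0] a0 * sh [1] a1, where a1 starts with Dr r',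
   is absorbed into Dr r'.+1 if r <= r'; if r' < r it produces a product u⋆v whose
   rightmost variables are in the wrong order. *)
Lemma LD_decomp t a t' : increasing t -> act t a = Some t' -> ordered t' ->
  exists r a0 a1, a = Dr r * sh [:: false] a0 * sh [:: true] a1.
Proof.
have [n] := ubnP (tsize t'); elim: n t a t' => // n IH t a t' le_n.
elim/LD_rcons_ind: a le_n => [|b a _] le_n inc_t.
  by exists 0%N, 1, 1; rewrite !sh1 !mulg1.
case/act_Some=> t'' ta t''b ord_t'.
have lt'' := act_tsize_D t''b; move: t''b; rewrite act_D => t''b.
have ord_t'' := ordered_actD t''b ord_t'.
have [|r [a0 [a1 ea]]] := IH t a t'' _ inc_t ta ord_t''; first by lia.
case: t inc_t ta => [i|t1 s] inc_t ta.
  have [_ et''] := act_Var ta; move: t''b; rewrite et''.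
  by case: b => [|[]].
move: ta; rewrite ea -mulgA => /act_Some[w tr wa].
have [u [v [ew eu su sv ev]]] := act_Dr tr.
move: wa; rewrite ew actM act_sh0; case ua: (act u a0) => [u''|] //=.
rewrite act_sh1; case va: (act v a1) => [v''|] //= -[et''].
rewrite -et'' in t''b ord_t'' lt''.
case: b t''b => [|[] b] /=.
- case: v'' va et'' ord_t'' lt'' => [//|p q] va et'' ord_t'' lt'' [et'].
  have inc_v : increasing v by apply: subseq_pairwise sv inc_t.
  have ord_v'' : ordered (p ⋆ q) by case/and3P: ord_t''.
  have [|r' [q0 [q1 ea1]]] := IH v a1 _ _ inc_v va ord_v''.
    by rewrite /= in lt'' *; lia.
  have le_rr' : (r <= r')%N.
    rewrite leqNgt; apply/negP=> lt_r'r.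
    case: v va inc_v ev sv {ew} => [i|v1 v2] va inc_v ev sv.
      by have [_] := act_Var va.
    move: va; rewrite ea1 -mulgA => /act_Some[w' vr' w'q].
    have [u' [v' [ew' eu' _ _ _]]] := act_Dr vr'.
    move: w'q; rewrite ew' actM act_sh0; case uq: (act u' q0) => [p'|] //=.
    rewrite act_sh1; case vq: (act v' q1) => [q'|] //= -[ep eq].
    have : (varR u'' < varR p)%N by move: ord_t'; rewrite -et' => /= /and3P[_ /and3P[]].
    rewrite -ep (varR_act uq) (varR_act ua) eu eu' ev // ltnNge.
    by rewrite ltnW // varRn_lt // tr.
  have [y0 [y1 ey]] := Dr_absorb le_rr'.
  exists r'.+1, (y0 * (sh [:: false] a0 * sh [:: true] q0)),
    (y1 * (sh [:: false] a0 * sh [:: true] q1)).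
  move: (Dr r'.+1) ey => X ey; apply: LDmul_ext => z.
  rewrite ea1 !shM !sh_sh -!mulgA /= sh_slide11 sh_slide10.
  rewrite (sh01C a0) sh_slide0.
  have ey' u1 : Dr r * (sh [:: true] (Dr r') * (D [::] * u1)) =
      X * (sh [:: false] y0 * (sh [:: true] y1 * u1)).
    by move: ey => /(congr1 (fun m => m * u1)); rewrite -!mulgA.
  rewrite ey' (sh_orth _ _ _ (q := [:: true]) (r := [:: false; false])) //.
  rewrite (sh_orth _ _ _ (q := [:: true; false]) (r := [:: false; true])) //.
  by rewrite (sh_orth _ _ _ (q := [:: true]) (r := [:: false; true])).
- case E: (actD v'' b) => [s'|] //= _.
  exists r, a0, (a1 * D b).
  by rewrite shM sh_D !mulgA.
- case E: (actD u'' b) => [s'|] //= _.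
  exists r, (a0 * D b), a1; apply: LDmul_ext => z.
  by rewrite shM sh_D -!mulgA -(sh_orthD b _ _ (q := [:: false])).
Qed.

(** The action preserves rightmost variables, so the one of the left half of t' determines r. The
    halves after [Dr r] then coincide, and induction applies to each. *)
Lemma increasing_faithful t a b t' : increasing t -> ordered t' ->
  act t a = Some t' -> act t b = Some t' -> a = b.
Proof.
have [n] := ubnP (tsize t'); elim: n t a b t' => // n IH t a b t' le_n.
move=> inc_t ord_t' ta tb.
have [r [a0 [a1 ea]]] := LD_decomp inc_t ta ord_t'.
have [r' [b0 [b1 eb]]] := LD_decomp inc_t tb ord_t'.
case: t inc_t ta tb => [i|t1 s] inc_t ta tb.
  by have [-> _] := act_Var ta; have [-> _] := act_Var tb.
have dec k c0 c1 : act (t1 ⋆ s) (Dr k * sh [:: false] c0 * sh [:: true] c1)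
    = Some t' -> exists u v u' v', [/\ t' = u' ⋆ v',
      act (t1 ⋆ s) (Dr k) = Some (u ⋆ v), varR u = varRn k (t1 ⋆ s) &
      [/\ increasing u, increasing v, act u c0 = Some u' & act v c1 = Some v']].
  rewrite -mulgA => /act_Some[w tk]; have [u [v [ew eu su sv _]]] := act_Dr tk.
  rewrite ew actM act_sh0; case ua: (act u c0) => [u'|] //=.
  rewrite act_sh1; case va: (act v c1) => [v'|] //= -[<-].
  exists u, v, u', v'; split=> //; first by rewrite -ew.
  by split=> //; [apply: subseq_pairwise su _ | apply: subseq_pairwise sv _].
rewrite ea in ta; rewrite eb in tb.
have [u [v [u' [v' [et' tr eu [incu incv ua va]]]]]] := dec _ _ _ ta.
have [x [y [x' [y' [et'' tr' ex [incx incy xa ya]]]]]] := dec _ _ _ tb.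
move: et'' le_n ord_t'; rewrite et' => -[eu' ev'] le_n /= /and3P[_ ord_u ord_v].
have err' : r = r'.
  have e : varRn r (t1 ⋆ s) = varRn r' (t1 ⋆ s).
    by rewrite -eu -ex -(varR_act ua) -(varR_act xa) eu'.
  case: (ltngtP r r') => // lt_r.
    by have := varRn_lt inc_t (r := r') _ lt_r; rewrite tr' e ltnn => /(_ isT).
  by have := varRn_lt inc_t (r := r) _ lt_r; rewrite tr e ltnn => /(_ isT).
move: tr'; rewrite -err' tr => -[exu eyv]; rewrite -exu -eu' in xa.
rewrite -eyv -ev' in ya; rewrite /= in le_n.
have := tsize_gt0 u'; have := tsize_gt0 v' => v0 u0.
rewrite ea eb -err' (IH u a0 b0 u') //; last by lia.
by rewrite (IH v a1 b1 v') //; lia.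
Qed.

Lemma mem_leaves_distr p q x :
  x \in leaves (distr p q) -> (x \in leaves p) || (x \in leaves q).
Proof.
elim: q => [i|q0 IH0 q1 IH1] /=; rewrite ?mem_cat //.
by case/orP=> [/IH0|/IH1] /orP[->|->]; rewrite ?orbT.
Qed.

Lemma varR_distr p q : varR (distr p q) = varR q.
Proof. by elim: q. Qed.

Lemma mem_leaves_phi t x : x \in leaves (phi t) -> x \in leaves t.
Proof.
elim: t => [//|t1 IH1 t2 IH2] /= /mem_leaves_distr.
by rewrite mem_cat => /orP[/IH1|/IH2] ->; rewrite ?orbT.
Qed.

Lemma varR_phi t : varR (phi t) = varR t.
Proof. by elim: t => //= t1 _ t2 IH; rewrite varR_distr. Qed.

Lemma ordered_distr p q : ordered p -> ordered q ->
  (forall x, x \in leaves q -> varR p < x)%N -> ordered (distr p q).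
Proof.
move=> op; elim: q => [i|q0 IH0 q1 IH1] /=.
  by move=> _ lt_p; rewrite op lt_p // mem_head.
case/and3P=> lt01 o0 o1 lt_p; rewrite !varR_distr lt01 IH0 ?IH1 //=.
  by move=> x xq; apply: lt_p; rewrite mem_cat xq orbT.
by move=> x xq; apply: lt_p; rewrite mem_cat xq.
Qed.

Lemma ordered_phi t : increasing t -> ordered (phi t).
Proof.
rewrite /increasing; elim: t => [//|t1 IH1 t2 IH2] /=.
rewrite pairwise_cat => /and3P[/allrelP lt12 /IH1 o1 /IH2 o2].
apply: ordered_distr => // x /mem_leaves_phi xt2; rewrite varR_phi.
exact: lt12 (varR_leaves t1) xt2.
Qed.

Lemma distr_inj p q p' q' : distr p q = distr p' q' -> p = p' /\ q = q'.
Proof.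
have distrN s u i : distr s u <> Var i by case: u.
elim: q q' => [i|q0 IH0 q1 IH1] [j|q0' q1'] //= [].
- by move=> -> ->.
- by move=> _ /esym/distrN.
- by move=> _ /distrN.
- by move=> /IH0[? ->] /IH1[? ->].
Qed.

Lemma phi_inj : injective phi.
Proof.
have distrN s u i : distr s u <> Var i by case: u.
elim=> [i|t1 IH1 t2 IH2] [j|s1 s2] //=.
- by move/esym/distrN.
- by move/distrN.
- by case/distr_inj=> /IH1 -> /IH2 ->.
Qed.

(* DeltaLD t depends only on the shape of t, so its leaves may be relabelled
   increasingly. *)
Fixpoint erase (t : term) : term :=
  if t is t1 ⋆ t2 then erase t1 ⋆ erase t2 else Var 0.

Fixpoint label (n : nat) (t : term) : term :=
  if t is t1 ⋆ t2 then label n t1 ⋆ label (n + tsize t1) t2 else Var n.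

Lemma erase_label n t : erase (label n t) = erase t.
Proof. by elim: t n => //= t1 IH1 t2 IH2 n; rewrite IH1 IH2. Qed.

Lemma leaves_label n t : leaves (label n t) = iota n (tsize t).
Proof. by elim: t n => //= t1 IH1 t2 IH2 n; rewrite IH1 IH2 iotaD. Qed.

Lemma increasing_label n t : increasing (label n t).
Proof.
rewrite /increasing leaves_label -sorted_pairwise; last exact: ltn_trans.
exact: iota_ltn_sorted.
Qed.

Lemma erase_distr p q : erase (distr p q) = distr (erase p) (erase q).
Proof. by elim: q => //= q0 -> q1 ->. Qed.

Lemma erase_phi t : erase (phi t) = phi (erase t).
Proof. by elim: t => //= t1 IH1 t2 IH2; rewrite erase_distr IH1 IH2. Qed.

Lemma delta_erase t : delta (erase t) = delta t.
Proof. by elim: t => //= t1 -> t2 ->. Qed.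

Lemma DeltaLD_erase t : DeltaLD (erase t) = DeltaLD t.
Proof. by elim: t => //= t1 -> t2 ->; rewrite -erase_phi delta_erase. Qed.

Lemma actD_erase t a : actD (erase t) a = omap erase (actD t a).
Proof.
elim: a t => [|[] a IH] [i|t1 t2] //=; first by case: t2.
  by rewrite IH; case: (actD t2 a).
by rewrite IH; case: (actD t1 a).
Qed.

Lemma act_erase t a : act (erase t) a = omap erase (act t a).
Proof.
elim/LD_ind: a t => [|a m IH] t; first by rewrite !act1.
by rewrite !actM !act_D actD_erase; case: (actD t a) => //= s.
Qed.

Lemma Phi_label t a t' : act t a = Some t' ->
  exists2 t2, act (label 0 t) a = Some t2 & Phi (label 0 t) a = Phi t a.
Proof.
move=> ta; have := act_erase (label 0 t) a.
rewrite erase_label act_erase ta /=; case E: (act _ a) => [t2|] //= -[e].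
exists t2 => //; apply: (Phi_uniq E).
rewrite -(DeltaLD_erase t2) -e -(DeltaLD_erase (label 0 t)) erase_label.
by rewrite !DeltaLD_erase (PhiP ta).
Qed.

(** Equal images give equal relabelled targets, as [phi] is injective on terms. That target expands
    to the ordered term [phi (label 0 t)], so it is ordered and [increasing_faithful] applies. *)
Lemma simple_Phi_inj t a b :
  simple_at t a -> simple_at t b -> Phi t a = Phi t b -> a = b.
Proof.
move=> /[dup] [[a' ea]] /simple_act[ta tae] /[dup] [[b' eb]] /simple_act[tb tbe].
have [ta' tae' <-] := Phi_label tae; have [tb' tbe' <-] := Phi_label tbe.
move=> e; have := act_Phi tae'; rewrite e (act_Phi tbe') => -[/phi_inj etab].
rewrite etab in tbe'.
apply: (increasing_faithful (increasing_label 0 t) _ tae' tbe').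
have act_a' : act ta' a' = Some (phi (label 0 t)).
  by rewrite -(act_comp _ tae') ea -DeltaLD_erase -(erase_label 0) DeltaLD_erase act_DeltaE.
exact: ordered_act act_a' (ordered_phi (increasing_label 0 t)).
Qed.

(** * Heads and regularity *)

Definition LDmor t t' a (e : act t a = Some t') : @hom LDcat t t' :=
  exist _ a (introT eqP e).

Lemma LDhomP t t' (f : @hom LDcat t t') : act t (val f) = Some t'.
Proof. by case: f => a /= /eqP. Qed.

Lemma LDarrow_eq t t1 t2 (f : @hom LDcat t t1) (g : @hom LDcat t t2) :
  val f = val g -> Arrow f = Arrow g.
Proof.
move=> e; have := LDhomP f; rewrite e LDhomP => -[e12].
by case: _ / e12 f e => f /val_inj ->.
Qed.

Lemma LDldiv t t1 t2 (f : @hom LDcat t t1) (g : @hom LDcat t t2) :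
  ldiv f g <-> dvd (val f) (val g).
Proof.
split=> [[h <-]|[x fx]]; first by exists (val h).
have e : act t1 x = Some t2 by rewrite -(act_comp _ (LDhomP f)) fx LDhomP.
by exists (LDmor e); apply: val_inj.
Qed.

Lemma LDsimple t t' (f : @hom LDcat t t') :
  simple LDgarside f <-> simple_at t (val f).
Proof. exact: LDldiv. Qed.

Lemma LDnontrivial t t' (f : @hom LDcat t t') : nontrivial f <-> val f <> 1.
Proof.
split=> [nt f1|f1 z].
  apply: (nt t); apply: LDarrow_eq; exact: f1.
by move/(congr1 (fun h : arrow LDcat => val (mor h))).
Qed.

Definition head t h a := [/\ simple_at t h, dvd h a &
  forall s, simple_at t s -> dvd s a -> dvd s h].

(** Maximal becomes greatest: the lcm of f with another simple divisor is again a simple divisor, so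
    maximality forces it to be f. *)
Lemma LDnormal t t1 t2 (f : @hom LDcat t t1) (g : @hom LDcat t1 t2) :
  normal LDgarside f g <->
  simple_at t1 (val g) /\ head t (val f) (val f * val g).
Proof.
split=> [[/LDsimple sf /LDsimple sg [[_ _ maxf] _]]|[sg [sf _ maxf]]].
  split=> //; split=> //; first exact: dvd_mulr.
  move=> s ss [x sx]; have [c [d [e lcmP]]] := lcm_total s (val f).
  have [w [_ ew]] := lcmP _ _ sx.
  have [t' td] : exists t', act t1 d = Some t'.
    by have := LDhomP g; rewrite ew => /act_Some[t' ? _]; exists t'.
  have tfd : act t (val f * d) = Some t' by rewrite (act_comp _ (LDhomP f)).
  have d1 : d = 1.
    apply: contrapT => nd; apply: (maxf _ (LDmor tfd)).
    - apply/LDsimple; case: ss sf => [y sy] [z fz].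
      have [v [_ ev]] := lcmP _ _ (etrans sy (esym fz)).
      by exists v; rewrite /= -mulgA -ev.
    - by apply/LDldiv; exists w; rewrite /= -mulgA -ew.
    - by exists (LDmor td); [apply/LDnontrivial | apply: val_inj].
  by exists c; rewrite e d1 mulg1.
have sf' : simple LDgarside f by apply/LDsimple.
split=> //; first by apply/LDsimple.
have ffg : ldiv f (mcomp f g) by exists g.
split.
  split=> // y h /LDsimple sh /LDldiv hfg [k /LDnontrivial nk e].
  apply: nk; have [x] := maxf _ sh hfg; rewrite -e /= -mulgA -[RHS]mulg1.
  by move/LDmulI/LD_mul_eq1.
move=> y h [/LDsimple sh /LDldiv hfg maxh]; apply: LDarrow_eq.
have /LDldiv[k e] := maxf _ sh hfg; rewrite -[in RHS]e.
have [k1|nk] := EM (val k = 1); first by rewrite [RHS]/= [X in _ * X]k1 mulg1.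
by case: (maxh _ f sf' ffg); exists k => //; apply/LDnontrivial.
Qed.

Section Regular.
Hypothesis reg : regular LDgarside.

(** Regularity enters here, translated from morphisms to heads of two-factor products in LD+. *)
Lemma normal_Phi t a t' b : act t a = Some t' -> simple_at t' b ->
  head t a (a * b) -> head (phi t) (Phi t a) (Phi t a * Phi t' b).
Proof.
move=> ta sb hab; have [t'' tb] := simple_act sb.
have [[a' ea] [b' eb]] : simple_at t a /\ simple_at t' b by case: hab.
have [sa _ _] := hab.
have star2 u c u' c' (e : act u c = Some u') : c * c' = DeltaLD u ->
    is_star2 LDgarside (LDmor e) (LDmor (act_Phi e)).
  move=> ec.
  have e' : act u' c' = Some (phi u) by rewrite -(act_comp _ e) ec act_DeltaE.
  exists (LDmor e'); apply: val_inj => //=; exact: simple_star ec.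
have /LDnormal[_ //] : normal LDgarside (LDmor (act_Phi ta)) (LDmor (act_Phi tb)).
apply: (reg (f1 := LDmor ta) (f2 := LDmor tb)).
- exact/LDsimple.
- exact/LDsimple.
- exact: star2 ea.
- exact: star2 eb.
- by apply/LDnormal.
Qed.

End Regular.

(** Starting from 1, a simple divisor that is not greatest is replaced by its lcm with one that it
    misses; the climb stops because sizes of targets stay at most [tsize t']. *)
Lemma head_exists t a t' : act t a = Some t' -> exists h, head t h a.
Proof.
move=> ta.
have [h [th [sh ha eh]]] : exists h th,
    [/\ simple_at t h, dvd h a & act t h = Some th].
  exists 1, t; split; [exact: simple1 | by exists a; rewrite mul1g |].
  exact: act1.
have [n] := ubnP (tsize t' - tsize th); elim: n h th sh ha eh => // n IH h th.
move=> sh ha eh le_n.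
have [H|/existsNP[s /not_implyP[ss /not_implyP[sa nsh]]]] :=
  EM (forall s, simple_at t s -> dvd s a -> dvd s h); first by exists h.
have [c [d [e lcmP]]] := lcm_total s h.
have [[x sx] [y hy]] := (sa, ha).
have [w [_ ew]] := lcmP _ _ (etrans sx (esym hy)).
have sl : simple_at t (h * d).
  have [[u su] [v hv]] := (ss, sh).
  have [z [_ ez]] := lcmP _ _ (etrans su (esym hv)).
  by exists z; rewrite -mulgA -ez.
have [tl tle] := simple_act sl; have := tle; rewrite (act_comp _ eh) => thd.
have tlw : act tl w = Some t' by rewrite -(act_comp _ tle) -mulgA -ew hy.
apply: (IH (h * d) tl) => //; first by exists w; rewrite -mulgA -ew.
have : tsize tl <> tsize th.
  move=> e1; apply: nsh; exists c; rewrite e.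
  by rewrite (act_same_tsize thd e1) mulg1.
by have := act_tsize thd; have := act_tsize tlw; lia.
Qed.

Lemma head_neq1 t h a t' : act t a = Some t' -> head t h a -> h = 1 -> a = 1.
Proof.
case: (LD_case a) => [//|[b [m ->]]] /act_Some[t1 tb _] [_ _ maxh] h1.
have := maxh _ (D_simple tb) (dvd_mulr _ _).
by rewrite h1 => -[x /LD_mul_eq1 e]; have := @mulD_neq1 1 b; rewrite mul1g e.
Qed.

(** * Injectivity of the functor and right cancellation *)

Section RegularInj.
Hypothesis reg : regular LDgarside.

(** Write a = h g and let h2 be the head of g. If s is a simple divisor of phi(h) phi(g), its lcm
    with phi(h) is phi(h) d with d simple. By induction d divides phi(h2), so s divides phi(h)
    phi(h2), whose head is phi(h) by regularity. *)
Lemma head_Phi t a t' h : act t a = Some t' -> head t h a ->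
  head (phi t) (Phi t h) (Phi t a).
Proof.
have [n] := ubnP (tsize t' - tsize t); elim: n t a h => // n IH t a h le_n.
move=> ta hh; have [a1|na1] := EM (a = 1).
  case: hh; rewrite a1 => _ [x /LD_mul_eq1 ->] _; rewrite Phi1; split=> //.
  - exact: simple1.
  - by exists 1; rewrite mulg1.
have [sh [g ea] maxh] := hh; have [th eh] := simple_act sh.
move: ta; rewrite -ea (act_comp _ eh) => thg.
have lt_th : (tsize t < tsize th)%N.
  rewrite ltn_neqAle (act_tsize eh) andbT; apply/eqP => e.
  apply: na1; apply: (head_neq1 _ hh).
    by rewrite -ea (act_comp _ eh); exact: thg.
  exact: act_same_tsize eh (esym e).
have [h2 hh2] := head_exists thg; have [sh2 h2g maxh2] := hh2.
have [_ _ maxP2] : head (phi th) (Phi th h2) (Phi th g).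
  by apply: IH hh2 => //; have := act_tsize thg; lia.
have hnorm : head t h (h * h2).
  split=> // [|s ss shh2]; first exact: dvd_mulr.
  by apply: maxh => //; rewrite -ea; apply: dvd_trans shh2 _; apply/dvd_mull.
have [_ _ maxP] := normal_Phi reg eh sh2 hnorm.
rewrite (PhiM eh) ?thg //; split; [exact: simple_Phi | exact: dvd_mulr |].
move=> s ss [x sx]; apply: maxP => //.
have [c [d lcmcd]] := lcm_total s (Phi t h); have [e lcmP] := lcmcd.
have sd := simple_residue ss (act_Phi eh) lcmcd.
have [w [_ ew]] := lcmP _ _ sx.
apply: (@dvd_trans _ (Phi t h * d)); first by exists c.
by apply/dvd_mull/maxP2 => //; exists w.
Qed.

Lemma Phi_inj t a b t' t'' : act t a = Some t' -> act t b = Some t'' ->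
  Phi t a = Phi t b -> a = b.
Proof.
have [n] := ubnP (tsize t' - tsize t); elim: n t a b => // n IH t a b le_n.
move=> ta tb eab; have [h hh] := head_exists ta; have [k hk] := head_exists tb.
have hk_eq : h = k.
  have [sh _ _] := hh; have [sk _ _] := hk.
  apply: (simple_Phi_inj sh sk).
  have [shP hP maxhP] := head_Phi ta hh; have [skP kP maxkP] := head_Phi tb hk.
  apply: dvd_anti; first by apply: maxkP => //; rewrite -eab.
  by apply: maxhP => //; rewrite eab.
have [h1|nh1] := EM (h = 1).
  by rewrite (head_neq1 ta hh h1) (head_neq1 tb hk (etrans (esym hk_eq) h1)).
have [sh [a' ea] _] := hh; have [_ [b' eb] _] := hk; rewrite -hk_eq in eb.
have [th eh] := simple_act sh.
move: ta tb eab; rewrite -ea -eb !(act_comp _ eh) => ta tb.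
rewrite !(PhiM eh) ?ta ?tb // => /LDmulI eab; congr (h * _).
apply: (IH _ _ _ _ ta tb eab).
have : tsize th <> tsize t by move=> e; apply/nh1/(act_same_tsize eh e).
by have := act_tsize eh; have := act_tsize ta; lia.
Qed.

Lemma actD_inj a s t u : actD s a = Some u -> actD t a = Some u -> s = t.
Proof.
elim: a s t u => [|[] a IH] [i|s1 s2] [j|t1 t2] u //=.
- by case: s2 => [//|s2 s3]; case: t2 => [//|t2 t3] [<-] [-> -> _ ->].
- case E: (actD s2 a) => [s|] //= [<-]; case F: (actD t2 a) => [t|] //= [-> ets].
  by rewrite ets in F; rewrite (IH _ _ _ E F).
- case E: (actD s1 a) => [s|] //= [<-]; case F: (actD t1 a) => [t|] //= [ets ->].
  by rewrite ets in F; rewrite (IH _ _ _ E F).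
Qed.

Lemma LDmulIr : right_cancellative LDplus.
Proof.
move=> a b c; elim/LD_rcons_ind: c => [|x c IH]; first by rewrite !mulg1.
rewrite !mulgA => e; apply: IH.
have [t [t' [_ [ta _]]]] := act_common_term (a * c * D x) 1.
have tb := ta; rewrite e in tb.
move: ta tb => /act_Some[ta ta1 ta2] /act_Some[tb tb1 tb2].
have eab : ta = tb.
  by move: ta2 tb2; rewrite !act_D; apply: actD_inj.
rewrite -eab in tb1; apply: (Phi_inj ta1 tb1).
have [d ed] := D_dvd_DeltaLD ta2.
apply: (@LDmulI (DeltaLD t)); rewrite /= -(PhiP ta1) -(PhiP tb1) ed.
by rewrite mulgA e mulgA.
Qed.

End RegularInj.

(** * Groups of fractions *)

(** The target group consists of all permutations of the set of fractions, on which the monoid acts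
    by left multiplication; this spares defining a product of fractions. *)
Definition bijections (X : Type) := {f : X -> X | bijective f}.

Section Bijections.
Variable X : Type.

HB.instance Definition _ := gen_eqMixin (bijections X).
HB.instance Definition _ := gen_choiceMixin (bijections X).

Implicit Types f g : bijections X.

Lemma bijections_eq f g : sval f =1 sval g -> f = g.
Proof.
case: f g => f bf [g bg] /= /funext e; case: _ / e bg => bg.
by congr exist; apply: Prop_irrelevance.
Qed.

Definition bij_one : bijections X := 
  exist _ id (Bijective (fun=> erefl) (fun=> erefl)).

Definition bij_mul f g : bijections X :=
  exist _ (sval f \o sval g) (bij_comp (svalP f) (svalP g)).

Lemma bij_inv_subproof f : exists g, cancel (sval f) (sval g) /\ cancel (sval g) (sval f).
Proof. by case: f => f [g fK gK]; exists (exist _ g (Bijective gK fK)). Qed.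

Definition bij_inv f : bijections X := sval (cid (bij_inv_subproof f)).

Lemma bij_mulA : associative bij_mul.
Proof. by move=> f g h; apply: bijections_eq. Qed.
Lemma bij_mul1 : left_id bij_one bij_mul.
Proof. by move=> f; apply: bijections_eq. Qed.
Lemma bij_mulr1 : right_id bij_one bij_mul.
Proof. by move=> f; apply: bijections_eq. Qed.
Lemma bij_mulV : left_inverse bij_one bij_inv bij_mul.
Proof.
move=> f; apply: bijections_eq => x; rewrite /bij_inv /=.
by case: cid => g [/= fK _]; rewrite fK.
Qed.
Lemma bij_mulrV : right_inverse bij_one bij_inv bij_mul.
Proof.
move=> f; apply: bijections_eq => x; rewrite /bij_inv /=.
by case: cid => g [/= _ gK]; rewrite gK.
Qed.

HB.instance Definition _ :=
  isGroup.Build (bijections X) bij_mulA bij_mul1 bij_mulr1 bij_mulV bij_mulrV.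

End Bijections.

Section Ore.
Variable M : monoidType.
Hypothesis mulI : right_injective (@mul M).
Hypothesis mulIr : right_cancellative M.
Hypothesis common : forall a b : M, exists x y, a * x = b * y.

(* [(a, b)] stands for the right fraction a b^-1. *)
Definition frac_eq (p q : M * M) : bool :=
  `[< exists u v, p.1 * u = q.1 * v /\ p.2 * u = q.2 * v >].

Lemma frac_equiv : equiv_class_of frac_eq.
Proof.
split.
- by move=> p; apply/asboolP; exists 1, 1.
- by move=> p q; apply/asboolP/asboolP => -[u [v [? ?]]]; exists v, u.
- move=> q p r /asboolP[u [v [e1 e2]]] /asboolP[u' [v' [e3 e4]]].
  have [x [y exy]] := common v u'.
  apply/asboolP; exists (u * x), (v' * y).
  by rewrite !mulgA e1 e2 -e3 -e4 -!mulgA exy.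
Qed.

Definition frac_rel := EquivRelPack frac_equiv.
Definition frac := {eq_quot frac_rel}.

Lemma frac_eqP p q : \pi_frac p = \pi_frac q <->
  exists u v, p.1 * u = q.1 * v /\ p.2 * u = q.2 * v.
Proof.
split=> [/eqP|h]; first by rewrite eqmodE => /asboolP.
by apply/eqP; rewrite eqmodE; apply/asboolP.
Qed.

Definition frac_mul m (x : frac) : frac :=
  \pi_frac (m * (repr x).1, (repr x).2).

Lemma frac_mul_pi m a b : frac_mul m (\pi_frac (a, b)) = \pi_frac (m * a, b).
Proof.
apply/frac_eqP; have /frac_eqP[u [v [/= e1 e2]]] := reprK (\pi_frac (a, b)).
by exists u, v; rewrite /= -!mulgA e1.
Qed.

Lemma fracW (P : frac -> Prop) : (forall a b, P (\pi_frac (a, b))) -> forall x, P x.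
Proof. by move=> Pab x; rewrite -(reprK x) [repr x]surjective_pairing. Qed.

Lemma frac_mul_bij m : bijective (frac_mul m).
Proof.
have inj : injective (frac_mul m).
  elim/fracW=> a b; elim/fracW=> c d; rewrite !frac_mul_pi => /frac_eqP.
  case=> u [v [/=]]; rewrite -!mulgA => /mulI e1 e2.
  by apply/frac_eqP; exists u, v.
have surj x : exists y, frac_mul m y = x.
  (* With m u = a v, the fraction a b^-1 equals (a v)(b v)^-1, which is m times u (b v)^-1. *)
  elim/fracW: x => a b; have [u [v e]] := common m a.
  exists (\pi_frac (u, b * v)); rewrite frac_mul_pi; apply/frac_eqP.
  by exists 1, v; rewrite /= !mulg1.
have gK x : frac_mul m (sval (cid (surj x))) = x by case: cid.
by exists (fun x => sval (cid (surj x))) => // x; apply: inj; rewrite gK.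
Qed.

Definition frac_embed (m : M) : bijections frac := exist _ _ (frac_mul_bij m).

Lemma ore_embedding : embeds_in_group M.
Proof.
exists (bijections frac : groupType), frac_embed; split.
  split=> [|m n]; apply: bijections_eq; elim/fracW=> a b /=.
    by rewrite frac_mul_pi mul1g.
  by rewrite (frac_mul_pi n) !frac_mul_pi mulgA.
move=> m n /(congr1 (fun f => sval f (\pi_frac (1, 1)))) /=.
rewrite !frac_mul_pi => /frac_eqP[u [v [/=]]].
by rewrite !mulg1 !mul1g => e euv; rewrite euv in e; apply: mulIr e.
Qed.

End Ore.

(** * Faithfulness of the action on terms *)

Section Blueprint.
Variables (G : groupType) (f : LDplus -> G).
Hypothesis f_morph : monoid_morphism f.
Local Notation d a := (f (D a)).

(* Modulo the action, [blueprint p t] turns a long right comb x⋆(x⋆...) at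
   address p into t⋆(x⋆(...)), by t⋆s acting as t, s, LD, t^-1; the factor
   D_(p0a) thus records the passage from t to t•D_a on the left. *)
Fixpoint blueprint (p : addr) (t : term) : G :=
  if t is t1 ⋆ t2 then
    blueprint p t1 * blueprint (rcons p true) t2 * d p
      * (blueprint (rcons p true) t1)^-1
  else 1.

Lemma blueprint_commute p t x :
  (forall q, commute x (d (p ++ q))) -> commute x (blueprint p t).
Proof.
elim: t p => [i|t1 IH1 t2 IH2] p xp /=; first exact: commute1.
have xp1 q : commute x (d (rcons p true ++ q)) by rewrite cat_rcons.
apply: commuteM; last exact/commuteV/IH1.
apply: commuteM; last by have := xp [::]; rewrite cats0.
by apply: commuteM; [apply: IH1 | apply: IH2].
Qed.

Lemma fM a b : f (a * b) = f a * f b.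
Proof. exact: f_morph.2. Qed.

Lemma d_orth a b : orth a b -> commute (d a) (d b).
Proof.
move=> ab; rewrite /commute -!fM; congr f.
by have := slide_orth [::] 1 ab; rewrite /= !mulg1.
Qed.

Lemma orth_pp p a b : orth (p ++ a) (p ++ b) = orth a b.
Proof. by elim: p => //= -[] p. Qed.

Lemma d_slide0 p b : d (p ++ false :: b) * d p =
  d p * d (p ++ [:: false, false & b]) * d (p ++ [:: true, false & b]).
Proof.
have := slide0 p [::] b 1; rewrite cats0 /= !mulg1 => /(congr1 f).
by rewrite !fM mulgA.
Qed.

Lemma d_slide10 p b : d (p ++ [:: true, false & b]) * d p =
  d p * d (p ++ [:: false, true & b]).
Proof.
have := slide10 p [::] b 1; rewrite cats0 /= !mulg1 => /(congr1 f).
by rewrite !fM.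
Qed.

Lemma d_slide11 p b : commute (d p) (d (p ++ [:: true, true & b])).
Proof.
have := slide11 p [::] b 1; rewrite cats0 /= !mulg1 => /(congr1 f).
by rewrite !fM.
Qed.

Lemma d_LD p : d p * d (rcons p true) * d p =
  d (rcons p true) * d p * d (rcons p true) * d (rcons p false).
Proof.
have := slideLD p [::] 1; rewrite cats0 /= !mulg1 !cats1 => /(congr1 f).
by rewrite !fM !mulgA.
Qed.

(** Letters below p0 commute with blueprints at p1. At the root the claim is the LD relation; below
    1 the letter crosses D_p and moves from p10 to p01; below 0 it splits in two, and the copy below
    p10 cancels against the inverse blueprint. *)
Lemma blueprint_actD p t a t' : actD t a = Some t' ->
  blueprint p t' = blueprint p t * d (p ++ false :: a).
Proof.
have bp0 q b s : commute (d (q ++ false :: b)) (blueprint (rcons q true) s).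
  apply: blueprint_commute => r; rewrite cat_rcons; apply: d_orth.
  by rewrite orth_pp.
elim: a p t t' => [|[] a IH] p [i|t1 t2] t' //=.
- case: t2 => [//|t2 t3] [<-] /=.
  have c11 s : commute (d p) (blueprint (rcons (rcons p true) true) s).
    by apply: blueprint_commute => r; rewrite -!cats1 -!catA; apply: d_slide11.
  have c0 s : commute (d (rcons p false)) (blueprint (rcons (rcons p true) true) s).
    apply: blueprint_commute => r; apply: d_orth.
    by rewrite -!cats1 -!catA orth_pp.
  have c0' := bp0 p [::]; have cLD := d_LD p.
  rewrite cats1 in c0' *.
  have c01 : commute (d (rcons p false)) (d (rcons p true)).
    by apply: d_orth; rewrite -!cats1 orth_pp.
  (* From here only these commutations and the LD relation matter, so blueprints and letters are
     generalised to arbitrary group elements. *)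
  move: c11 c0 c0' cLD c01.
  move: (blueprint (rcons (rcons p true) true)) => E.
  move: (blueprint (rcons p true)) (d p) (d (rcons p true)) (d (rcons p false)).
  move=> B x e z c11 c0 c0' cLD c01.
  have ct (g h y : G) : commute g h -> g * (h * y) = h * (g * y).
    by move=> gh; rewrite !mulgA gh.
  have cLDt (y : G) : x * (e * (x * y)) = e * (x * (e * (z * y))).
    by rewrite !mulgA cLD.
  rewrite !invgM !invgK -!mulgA; congr (_ * (_ * _)).
  rewrite mulKg (ct _ _ _ (c11 t1)) mulKg (ct _ _ _ (c11 t3)); congr (_ * _).
  rewrite cLDt (ct _ _ _ (commuteV c01)) mulVKg; congr (_ * _).
  rewrite -(commuteV (c0' t1)) -(ct _ _ _ (commuteV (c11 t2))).
  by rewrite -(ct _ _ _ (commuteV (c0 t2))).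
- case E: (actD t2 a) => [s|] //= [<-] /=; rewrite (IH _ _ _ E).
  rewrite cat_rcons -!mulgA; congr (_ * (_ * _)).
  rewrite (mulgA (d _)) d_slide10 -mulgA; congr (_ * _).
  by apply: commuteV; apply: bp0.
- case E: (actD t1 a) => [s|] //= [<-] /=; rewrite !(IH _ _ _ E).
  rewrite cat_rcons invgM -!mulgA; congr (_ * _).
  rewrite (mulgA (d _)) bp0 -mulgA; congr (_ * _).
  rewrite (mulgA (d (p ++ false :: _))) d_slide0 -!mulgA; congr (_ * _).
  rewrite mulVKg.
  by apply: commuteV; apply: bp0.
Qed.

Lemma blueprint_act p t a t' : act t a = Some t' ->
  blueprint p t' = blueprint p t * f (sh (rcons p false) a).
Proof.
elim/LD_ind: a t => [|a m IH] t.
  by rewrite act1 sh1 f_morph.1 mulg1 => -[->].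
case/act_Some=> t1; rewrite act_D => /(blueprint_actD p) e /IH ->.
by rewrite e shM sh_D fM cat_rcons mulgA.
Qed.

End Blueprint.

(** * Injectivity of the shifts and faithfulness *)

Definition headed (x : bool) : pred addr := fun a => ohead a == Some x.

Lemma LDrel_unshift x u v : LDrel u v -> all (headed x) u || all (headed x) v ->
  exists u' v', [/\ u = map (cons x) u', v = map (cons x) v' & LDrel u' v'].
Proof.
have hd y w : w != [::] -> all (headed x) (map (cons y) w) -> y = x.
  by case: w => //= a w _ /andP[/eqP[]].
have hd2 y u1 v1 : u1 != [::] -> v1 != [::] -> LDrel u1 v1 ->
    all (headed x) (map (cons y) u1) || all (headed x) (map (cons y) v1) ->
    exists u' v', [/\ map (cons y) u1 = map (cons x) u',
                      map (cons y) v1 = map (cons x) v' & LDrel u' v'].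
  by move=> u0 v0 uv /orP[/hd->|/hd->] //; exists u1, v1.
case=> [a b c|a b|a b|a b|a]; case: a => [|y a];
  try by [case: x {hd hd2}; rewrite /= /headed /= ?andbF].
- by apply: (hd2 y _ _ _ _ (LDrel_perp a b c)).
- by apply: (hd2 y _ _ _ _ (LDrel_0 a b)).
- by apply: (hd2 y _ _ _ _ (LDrel_10 a b)).
- by apply: (hd2 y _ _ _ _ (LDrel_11 a b)).
- by apply: (hd2 y _ _ _ _ (LDrel_LD a)).
Qed.

Lemma headed_map x w : all (headed x) (map (cons x) w).
Proof. by rewrite all_map; apply/allP => a _; exact: eqxx. Qed.

(** If one side of a relation lies entirely below x, so does the other; a derivation from such a
    word stays below x and can be read with x erased. *)
Lemma LDcong_unshift x u v : LDcong u v ->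
  all (headed x) u = all (headed x) v /\
  (all (headed x) u -> LDcong (map behead u) (map behead v)).
Proof.
elim=> {u v} [u v w w' ww'|w|w w' _ [e IH]|w w' w'' _ [e1 IH1] _ [e2 IH2]].
- have [|] := boolP (all (headed x) w || all (headed x) w').
    move=> /(LDrel_unshift ww')[u' [v' [-> -> uv']]].
    rewrite !all_cat !headed_map; split=> // _; rewrite !map_cat.
    by rewrite -!map_comp !map_id; apply: LDcong_rel.
  rewrite negb_or !all_cat => /andP[/negbTE-> /negbTE->].
  by rewrite !andbF.
- by split=> // _; apply: LDcong_refl.
- by rewrite -e; split=> // /IH /LDcong_sym.
- split; first by rewrite e1.
  move=> /[dup] /IH1 h1; rewrite e1 => /IH2; exact: LDcong_trans.
Qed.

Lemma sh_inj x : injective (sh [:: x]).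
Proof.
elim/LDplusW=> u; elim/LDplusW=> v; rewrite !sh_pi => /LDpi_eq /(LDcong_unshift x)[_].
move/(_ (headed_map x u)); rewrite -!map_comp !map_id => uv.
exact/LDpi_eq.
Qed.

Lemma embedding_faithful : embeds_in_group LDplus ->
  forall t a b t', act t a = Some t' -> act t b = Some t' -> a = b.
Proof.
move=> [G [f [f_morph f_inj]]] t a b t' ta tb; apply/(@sh_inj false)/f_inj.
apply: (@mulgI G (blueprint f [::] t)).
by rewrite -(blueprint_act f_morph [::] ta) -(blueprint_act f_morph [::] tb).
Qed.

Lemma LDplus_embeds : right_cancellative LDplus -> embeds_in_group LDplus.
Proof.
move=> mulIr; apply: ore_embedding LDmulI mulIr _ => a b.
by have [c [d [e _]]] := lcm_total a b; exists c, d.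
Qed.

(** * The functor on morphisms and the equivalent properties *)

Lemma LDexpP t t' : LDexp t t' <-> exists a, act t a = Some t'.
Proof.
split=> [[w e]|[a]]; first by exists (\pi_LDplus w); rewrite act_pi.
by elim/LDplusW: a => w; rewrite act_pi; exists w.
Qed.

Definition LDfunctor t t' (f : @hom LDcat t t') : @hom LDcat (phi t) (phi t') :=
  LDmor (act_Phi (LDhomP f)).

Lemma is_star2_Phi t t' (f : @hom LDcat t t') g : simple LDgarside f ->
  is_star2 LDgarside f g <-> val g = Phi t (val f).
Proof.
case=> h e; have hE : val f * val h = DeltaLD t := congr1 val e.
split=> [[f' /(congr1 val) /= e1 /(congr1 val) /= e2]|eg].
  by apply: (@LDmulI (val f')); rewrite /= (simple_star (LDhomP f) e1).
exists h => //; apply: val_inj; rewrite /= eg.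
exact: simple_star (LDhomP f) hE.
Qed.

Lemma LDfunctor_assoc : associated_functor LDgarside LDfunctor.
Proof.
split; last by move=> t t' f sf; apply/is_star2_Phi.
split=> [t|t t' t'' f g]; apply: val_inj => /=; first exact: Phi1.
by apply: PhiM (LDhomP f) _; rewrite LDhomP.
Qed.

(** Every morphism is a product of letters, and a letter is simple wherever it applies, so the
    values on simple morphisms determine the functor. *)
Lemma associated_functor_uniq F' : associated_functor LDgarside F' ->
  forall t t' (f : @hom LDcat t t'), F' t t' f = LDfunctor f.
Proof.
move=> [[F1 FM] Fs] t t' f; apply: val_inj => /=.
case: f => a /=; elim/LD_ind: a t => [|a m IH] t e.
  have et : t = t' by move: e; rewrite act1 => /eqP[].
  case: _ / et e => e; rewrite Phi1 -[RHS]/(val (idm (phi t : obj LDcat))) -F1.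
  by congr (val (F' _ _ _)); apply: val_inj.
have [t1 ta tm] := act_Some (eqP e).
have -> : exist _ (D a * m) e = mcomp (LDmor ta) (LDmor tm) by apply: val_inj.
rewrite FM /= IH (PhiM ta) ?tm //; congr (_ * _).
have sa : simple LDgarside (LDmor ta) by apply/LDsimple/D_simple/ta.
by have /is_star2_Phi := Fs _ _ _ sa; apply.
Qed.

Section Faithful.
Hypothesis faithful :
  forall t a b t', act t a = Some t' -> act t b = Some t' -> a = b.

Lemma LDcat_isomorphic : isomorphic LDcat0 LDcat.
Proof.
have hom_eq t t' (f g : @hom LDcat t t') : f = g.
  by apply: val_inj; apply: faithful (LDhomP f) (LDhomP g).
pose F1 t t' (f : @hom LDcat0 t t') : @hom LDcat t t' :=
  let: exist a e := cid ((LDexpP t t').1 f) in LDmor e.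
pose G (f : arrow LDcat) : arrow LDcat0 :=
  @Arrow LDcat0 (src f) (tgt f)
    ((LDexpP _ _).2 (ex_intro _ (val (mor f)) (LDhomP (mor f)))).
exists id, F1; split; first by split=> *; apply: hom_eq.
  by exists id.
exists G => [[t t' f]|[t t' f]]; rewrite /G /on_arrows /=.
  by congr Arrow; apply: (@Prop_irrelevance (LDexp t t')).
by congr Arrow; apply: hom_eq.
Qed.

(** The join of t•a and t•b is the image of t under the lcm of a and b. A common expansion is
    reached through a a' and b b', which faithfulness makes equal, so the lcm divides them;
    antisymmetry comes from [tsize]. *)
Lemma LDexp_semilattice t : upper_semilattice (LDexp t) LDexp.
Proof.
split.
- by move=> x _; apply: LDexp_refl.
- move=> x y _ _ /LDexpP[a xa] /LDexpP[b yb].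
  have := act_same_tsize xa; have := act_tsize xa; have := act_tsize yb.
  move=> le1 le2 /(_ _) a1; move: xa; rewrite a1; last by lia.
  by rewrite act1 => -[].
- by move=> x y z _ _ _; apply: LDexp_trans.
move=> x y /LDexpP[a xa] /LDexpP[b yb].
have [||u [v [e]]] := @common_multiple_at t a b; rewrite ?xa ?yb //.
have [c [d [ecd lcmP]]] := lcm_total a b; have [w [-> _]] := lcmP _ _ e.
case E: (act t _) => [t'|] // _; move: E; rewrite mulgA => /act_Some[z tz _].
exists z; split.
- by apply/LDexpP; exists (a * c).
- by apply/LDexpP; exists c; rewrite -(act_comp _ xa).
- by apply/LDexpP; exists d; rewrite -(act_comp _ yb) -ecd.
move=> z' _ /LDexpP[a' za'] /LDexpP[b' zb'].
have eab : a * a' = b * b'.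
  by apply: (@faithful t _ _ z'); rewrite ?(act_comp _ xa) ?(act_comp _ yb).
have [w' [ea' _]] := lcmP _ _ eab; apply/LDexpP; exists w'.
by rewrite -(act_comp _ tz) -mulgA -ea' (act_comp _ xa).
Qed.

(** By faithfulness, agreement at one term in both domains is enough, and such a term always
    exists. *)
Lemma LDcong_complete w w' :
  (forall t t1 t2, actw t w = Some t1 -> actw t w' = Some t2 -> t1 = t2) ->
  \pi_LDplus w = \pi_LDplus w'.
Proof.
move=> agree; have [t [t1 [t2 [e1 e2]]]] :=
  act_common_term (\pi_LDplus w) (\pi_LDplus w').
apply: (faithful e1); rewrite e2; rewrite !act_pi in e1 e2.
by rewrite (agree _ _ _ e1 e2).
Qed.

End Faithful.

Lemma LDfunctor_inj : regular LDgarside ->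
  associated_functor_injective LDgarside.
Proof.
move=> reg; exists LDfunctor; split.
- exact: LDfunctor_assoc.
- exact: associated_functor_uniq.
case=> [t t' f] [s s' g] e.
have ets : t = s by apply: phi_inj; exact: (congr1 (@src LDcat) e).
case: _ / ets g e => g /(congr1 (fun h : arrow LDcat => val (mor h))) /= e.
apply: LDarrow_eq; exact: (Phi_inj reg (LDhomP f) (LDhomP g) e).
Qed.

Theorem theorem6p2 :
  regular LDgarside ->
  embeds_in_group LDplus /\
  right_cancellative LDplus /\
  isomorphic LDcat0 LDcat /\
  associated_functor_injective LDgarside /\
  (forall t : term, upper_semilattice (LDexp t) LDexp) /\
  (forall w w' : word,
     (forall t t1 t2 : term,
        actw t w = Some t1 -> actw t w' = Some t2 -> t1 = t2) ->
     \pi_LDplus%qT w = \pi_LDplus%qT w').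
Proof.
move=> reg; have mulIr := LDmulIr reg; have emb := LDplus_embeds mulIr.
have faithful := embedding_faithful emb.
split=> //; split=> //; split; last split; last split.
- exact: LDcat_isomorphic.
- exact: LDfunctor_inj.
- exact: LDexp_semilattice.
- exact: LDcong_complete.
Qed.
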